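(* Let $\Omega\subseteq\mathbb{R}^n$ be open, let $N\ge 1$, and let $X_j=X_j(x,D)$, $0\le j\le N+1$, be homogeneous first order linear partial differential operators on $\Omega$ with smooth real coefficients, i.e. $X_j(x,D)=\sum_{k=1}^n a_{jk}(x)D_k$ with $a_{jk}\in C^\infty(\Omega;\mathbb{R})$. Let $f_1,\dots,f_N\in C^\infty(\Omega;\mathbb{R})$ and $a_0\in C^\infty(\Omega;\mathbb{C})$, and let $$P=\sum_{j=1}^N X_j^*f_jX_j+iX_0+X_{N+1}+a_0 .$$ Assume that: (i) $X_0(x,D)\neq 0$ for all $x\in\Omega$ (that is, for every $x\in\Omega$ the coefficient vector $(a_{01}(x),\dots,a_{0n}(x))$ is nonzero), and $iX_0f_j\ge 0$ on $\Omega$ for all $1\le j\le N$; (ii) $[X_0,X_j](x,D)=0$ in $\Omega$ for all $1\le j\le N$; (iii) for every $x_0\in\Omega$ there exist a bounded open set $U\subset\Omega$ containing $x_0$ and a constant $C>0$ such that $$|\{X_0,X_{N+1}\}(x,\xi)|^2\le C\left(\sum_{j=1}^N\bigl(iX_0f_j(x)\bigr)X_j(x,\xi)^2+X_0(x,\xi)^2\right)\quad\text{for all }(x,\xi)\in U\times\mathbb{R}^n .$$ Then, for every $x_0\in\Omega$, the operator $P$ is $L^2$ to $L^2$ locally solvable at $x_0$.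
   Context: Notation: $D=(D_1,\dots,D_n)=-i(\partial_{x_1},\dots,\partial_{x_n})$, so each $iX_j=\sum_k a_{jk}\partial_{x_k}$ is a real smooth vector field and $iX_0f_j=\sum_k a_{0k}\,\partial_{x_k}f_j$ is a real function. $X_j^*$ denotes the formal adjoint of $X_j$ with respect to the $L^2$ inner product, and $X_j^*f_jX_j$ is the composition of $X_j$, multiplication by $f_j$, and $X_j^*$. The functions $f_j$ may vanish and change sign, and the operators $X_j$ with $1\le j\le N+1$ may be degenerate (their coefficients may vanish at points of $\Omega$, and $X_{N+1}\equiv 0$ is allowed). $X_j(x,\xi)=\sum_k a_{jk}(x)\xi_k$ is the (total) symbol of $X_j(x,D)$, $[\cdot,\cdot]$ is the commutator of operators, and $\{p,q\}=\sum_{k=1}^n\bigl(\partial_{\xi_k}p\,\partial_{x_k}q-\partial_{x_k}p\,\partial_{\xi_k}q\bigr)$ is the Poisson bracket. Definition (local solvability). Let $H^s$ denote the $L^2$-based Sobolev space of order $s$. A partial differential operator $P$ on an open set $\Omega\subseteq\mathbb{R}^n$ is $H^s$ to $H^{s'}$ locally solvable at $x_0\in\Omega$ if there exists a compact set $K\subset\Omega$ with $x_0\in\mathring{K}=U$ (the interior of $K$) such that for all $g\in H^s_{\mathrm{loc}}(\Omega)$ there is $u\in H^{s'}_{\mathrm{loc}}(\Omega)$ which solves $Pu=g$ in $U$ (in the sense of distributions). ''$L^2$ to $L^2$ locally solvable'' means the case $s=s'=0$. *)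

(* Defs.v *)
From HB Require Import structures.
From mathcomp Require Import all_boot all_order all_algebra.
From mathcomp Require Import all_classical all_reals all_analysis.
From mathcomp Require Import complex.
Set Implicit Arguments.
Unset Strict Implicit.
Unset Printing Implicit Defensive.
Import Order.TTheory GRing.Theory Num.Theory.
Import numFieldNormedType.Exports.
Local Open Scope classical_set_scope.
Local Open Scope ring_scope.

(* R^n is 'rV[R]_n.  Its sigma-algebra is generated by the coordinates, i.e. it
   is the Borel one; as L^2_loc is only used up to a.e. equality, working with
   Borel rather than Lebesgue measurable functions is immaterial. *)
Section measurable_rV.
Context {R : realType} (n : nat).

Let coord (i : 'I_n) (x : 'rV[R]_n) : measurableTypeR R := x ord0 i.

Let rV_set0 : g_sigma_preimage coord set0.
Proof. exact: sigma_algebra0. Qed.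

Let rV_setC A : g_sigma_preimage coord A -> g_sigma_preimage coord (~` A).
Proof. exact: sigma_algebraC. Qed.

Let rV_bigcup (F : (set 'rV[R]_n)^nat) :
  (forall i, g_sigma_preimage coord (F i)) ->
  g_sigma_preimage coord (\bigcup_i (F i)).
Proof. exact: sigma_algebra_bigcup. Qed.

HB.instance Definition _ := @isMeasurable.Build
  (measure_tuple_display R.-ocitv.-measurable.-sigma)%mdisp
  'rV[R]_n (g_sigma_preimage coord) rV_set0 rV_setC rV_bigcup.

Lemma measurable_rV_coord (i : 'I_n) :
  measurable_fun [set: 'rV[R]_n]
    ((fun x => x ord0 i) : 'rV[R]_n -> measurableTypeR R).
Proof.
move=> _ Y mY; rewrite setTI; apply: sub_sigma_algebra => /=.
rewrite -bigcup_seq/=; exists i => /=; first by rewrite mem_index_enum.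
by exists Y => //; rewrite setTI.
Qed.

Lemma measurable_fun_rV d (T : measurableType d) (f : T -> 'rV[R]_n) :
  (forall i, measurable_fun [set: T]
     ((fun t => f t ord0 i) : T -> measurableTypeR R)) ->
  measurable_fun [set: T] f.
Proof.
move=> mf _ A mA; rewrite setTI.
suff : preimage_set_system [set: T] f (g_sigma_preimage coord) `<=` measurable.
  by apply; exists A => //; rewrite setTI.
have <- : g_sigma_preimage (fun i => coord i \o f) =
    preimage_set_system [set: T] f (g_sigma_preimage coord).
  exact: (@g_sigma_preimage_comp _ (measurableTypeR R) n 'rV[R]_n coord T f).
apply: smallest_sub; first exact: sigma_algebra_measurable.
rewrite -bigcup_seq; apply: bigcup_sub => i _ B [C mC <-].
exact: mf.
Qed.

End measurable_rV.

Lemma sigma_finite_prod d1 d2 (T1 : measurableType d1) (T2 : measurableType d2)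
    (R : realType) (m1 : {sigma_finite_measure set T1 -> \bar R})
    (m2 : {sigma_finite_measure set T2 -> \bar R}) :
  sigma_finite setT (m1 \x m2)%E.
Proof.
have /sigma_finiteP[F [TF ndF Foo]] := sigma_finiteT m1.
have /sigma_finiteP[G [TG ndG Goo]] := sigma_finiteT m2.
exists (fun n => F n `*` G n).
  rewrite -setXTT TF TG predeqE => -[x y]; split.
    move=> [/= [n _ Fnx] [k _ Gky]]; exists (maxn n k) => //; split.
    - by move: x Fnx; exact/subsetPset/ndF/leq_maxl.
    - by move: y Gky; exact/subsetPset/ndG/leq_maxr.
  by move=> [n _ []/= ? ?]; split; exists n.
move=> k; have [? ?] := Foo k; have [? ?] := Goo k.
split; first exact: measurableX.
by rewrite product_measure1E// lte_mul_pinfty// ge0_fin_numE.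
Qed.

Section lebesgue_rV.
Context {R : realType}.

Definition cons_rV (n : nat) (p : measurableTypeR R * 'rV[R]_n) :
  'rV[R]_n.+1 := row_mx (const_mx p.1 : 'rV_1) p.2.

Let uncons_rV (n : nat) (v : 'rV[R]_n.+1) : measurableTypeR R * 'rV[R]_n :=
  (v ord0 ord0, rsubmx (v : 'rV[R]_(1 + n))).

Lemma cons_rV0 n p : @cons_rV n p ord0 ord0 = p.1.
Proof.
have e : ord0 = lshift n (ord0 : 'I_1) by apply: val_inj.
rewrite /cons_rV e; apply: etrans (@row_mxEl R 1 1 n _ _ ord0 ord0) _.
exact: mxE.
Qed.

Lemma cons_rVS n p i : @cons_rV n p ord0 (lift ord0 i) = p.2 ord0 i.
Proof.
have e : lift ord0 i = rshift 1 i by apply: val_inj.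
by rewrite /cons_rV e (@row_mxEr _ 1 1 n).
Qed.

Let cons_rVK n : cancel (@cons_rV n) (@uncons_rV n).
Proof.
move=> [x v]; rewrite /uncons_rV cons_rV0.
by rewrite /cons_rV row_mxKr.
Qed.

Lemma measurable_cons_rV n : measurable_fun setT (@cons_rV n).
Proof.
apply: measurable_fun_rV => i; case: (unliftP ord0 i) => [j|] ->.
  rewrite (_ : (fun _ => _) =
    ((fun x : 'rV[R]_n => x ord0 j) : _ -> measurableTypeR R) \o snd).
    apply: measurableT_comp => //; exact: measurable_rV_coord.
  by apply/funext => p /=; rewrite cons_rVS.
rewrite (_ : (fun _ => _) = fst) //.
by apply/funext => p /=; rewrite cons_rV0.
Qed.

Let measurable_uncons_rV n : measurable_fun setT (@uncons_rV n).
Proof.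
apply/measurable_fun_pairP; split => /=; first exact: measurable_rV_coord.
apply: measurable_fun_rV => i.
rewrite (_ : (fun _ => _) = ((fun x : 'rV[R]_n.+1 => x ord0 (rshift 1 i))
   : _ -> measurableTypeR R)); last by apply/funext => v /=; rewrite mxE.
exact: measurable_rV_coord.
Qed.

Section cons_measure.
Local Open Scope ereal_scope.
Variables (n : nat) (mu : {sigma_finite_measure set 'rV[R]_n -> \bar R}).

Definition cons_measure : set 'rV[R]_n.+1 -> \bar R :=
  pushforward (lebesgue_measure \x mu) (@cons_rV n).

Let mpre (A : set 'rV[R]_n.+1) :
  measurable A -> measurable (@cons_rV n @^-1` A).
Proof. by move=> mA; rewrite -[X in measurable X]setTI; exact: measurable_cons_rV. Qed.

Let cons_measure0 : cons_measure set0 = 0.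
Proof. by rewrite /cons_measure /pushforward preimage_set0 measure0. Qed.

Let cons_measure_ge0 A : 0 <= cons_measure A.
Proof. by rewrite /cons_measure /pushforward; apply: measure_ge0. Qed.

Let cons_measure_sigma_additive : semi_sigma_additive cons_measure.
Proof.
move=> F mF tF mUF; rewrite /cons_measure /pushforward preimage_bigcup.
apply: measure_semi_sigma_additive => [k||].
- exact: mpre.
- apply/trivIsetP => /= i j _ _ ij; rewrite -preimage_setI.
  by move/trivIsetP : tF => /(_ _ _ _ _ ij) ->//; rewrite preimage_set0.
- by rewrite -preimage_bigcup; exact: mpre.
Qed.

HB.instance Definition _ := isMeasure.Build _ _ _ cons_measure
  cons_measure0 cons_measure_ge0 cons_measure_sigma_additive.

Let cons_measure_sigma_finite : sigma_finite setT cons_measure.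
Proof.
have [F FT mF] := sigma_finite_prod lebesgue_measure mu.
have uK B : @cons_rV n @^-1` (@uncons_rV n @^-1` B) = B.
  by apply/funext => p; rewrite /preimage/= cons_rVK.
exists (fun i => @uncons_rV n @^-1` (F i)).
  by rewrite -preimage_bigcup -FT preimage_setT.
move=> i; have [mFi Fi] := mF i; split.
  by rewrite -[X in measurable X]setTI; exact: measurable_uncons_rV.
by rewrite /cons_measure /pushforward uK.
Qed.

HB.instance Definition _ := Measure_isSigmaFinite.Build _ _ _ cons_measure
  cons_measure_sigma_finite.

End cons_measure.

(* n-dimensional Lebesgue measure: the iterated product measure, transported
   along R * R^n -> R^n.+1; on the one-point space R^0 it is the point mass. *)
Fixpoint lebesgue_rV (n : nat) : {sigma_finite_measure set 'rV[R]_n -> \bar R} :=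
  if n is m.+1 then cons_measure (lebesgue_rV m) else \d_(0 : 'rV[R]_0).

Lemma measurable_rV_box n (A : 'I_n -> set (measurableTypeR R)) :
  (forall i, measurable (A i)) ->
  measurable [set x : 'rV[R]_n | forall i, A i (x ord0 i)].
Proof.
move=> mA; rewrite (_ : [set _ | _] = \big[setI/setT]_(i < n)
    ((fun x : 'rV[R]_n => x ord0 i : measurableTypeR R) @^-1` A i)).
  apply: bigsetI_measurable => i _.
  by rewrite -[X in measurable X]setTI; exact: measurable_rV_coord.
rewrite -bigcap_seq; apply/seteqP; split => x /= Ax i.
  by move=> _; exact: Ax.
by apply: (Ax i) => /=; rewrite mem_index_enum.
Qed.

Lemma lebesgue_rV_box n (A : 'I_n -> set (measurableTypeR R)) :
  (forall i, measurable (A i)) ->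
  lebesgue_rV n [set x | forall i, A i (x ord0 i)] =
  (\prod_(i < n) lebesgue_measure (A i))%E.
Proof.
elim: n A => [|n IH] A mA /=.
  by rewrite big_ord0 diracE mem_set//= => -[].
rewrite (@big_ord_recl _ 1%E mule) /=.
rewrite -(IH (fun i => A (lift ord0 i))) => [|i]; last exact: mA.
rewrite -product_measure1E//; last first.
  by apply: (measurable_rV_box (A := fun i => A (lift ord0 i))) => i; exact: mA.
rewrite /cons_measure /pushforward; congr (_ _).
apply/seteqP; split=> -[x v] /= => [Axv|[Ax Av] i].
  split=> [|i]; first by have := Axv ord0; rewrite cons_rV0.
  by have := Axv (lift ord0 i); rewrite cons_rVS.
by case: (unliftP ord0 i) => [j|] ->; rewrite ?cons_rV0 ?cons_rVS.
Qed.

End lebesgue_rV.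

Section smooth.
Context {R : realType} {n : nat}.
Local Notation Rn := 'rV[R]_n.
Local Notation C := R[i].
Implicit Types (Om : set Rn) (f : Rn -> R) (phi : Rn -> C).

Definition partial (k : 'I_n) f : Rn -> R :=
  fun x => 'D_(delta_mx ord0 k : Rn) f x.

(* f is C^oo on the open set Om: the partial derivatives of all orders exist
   and are continuous on Om; nothing is asked of f outside Om. *)
Definition smooth Om f := forall (s : seq 'I_n) (x : Rn), Om x ->
  {for x, continuous (foldr partial f s)} /\
  forall k : 'I_n, derivable (foldr partial f s) x (delta_mx ord0 k : Rn).

Definition csmooth Om phi :=
  smooth Om (fun x => complex.Re (phi x)) /\
  smooth Om (fun x => complex.Im (phi x)).

Definition support phi : set Rn := closure [set x | phi x != 0].

Definition test_fun Om phi :=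
  [/\ csmooth setT phi, compact (support phi) & support phi `<=` Om].

(* D_k = -i d/dx_k *)
Definition Dop (k : 'I_n) phi : Rn -> C := fun x =>
  - 'i%C * (partial k (fun y => complex.Re (phi y)) x +i*
            partial k (fun y => complex.Im (phi y)) x)%C.

(* A vector field a has coefficients a x ord0 k; vf_op a is the operator
   X(x,D) = sum_k a_k(x) D_k, and vf_symbol a its symbol X(x,xi). *)
Definition vf_op (a : Rn -> Rn) phi : Rn -> C := fun x =>
  \sum_(k < n) (a x ord0 k)%:C%C * Dop k phi x.

Definition vf_symbol (a : Rn -> Rn) : Rn -> Rn -> R := fun x xi =>
  \sum_(k < n) a x ord0 k * xi ord0 k.

(* the real vector field iX = sum_k a_k d/dx_k, acting on real functions *)
Definition ivf (a : Rn -> Rn) f : Rn -> R := fun x =>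
  \sum_(k < n) a x ord0 k * partial k f x.

Definition poisson (p q : Rn -> Rn -> R) : Rn -> Rn -> R := fun x xi =>
  \sum_(k < n) (partial k (p x) xi * partial k (q ^~ xi) x -
                partial k (p ^~ xi) x * partial k (q x) xi).

Definition commutator (A B : (Rn -> C) -> (Rn -> C)) phi : Rn -> C :=
  fun x => A (B phi) x - B (A phi) x.

End smooth.

Section distributions.
Context {R : realType} {n : nat}.
Local Notation Rn := 'rV[R]_n.
Local Notation C := R[i].

Definition cintegral (D : set Rn) (u : Rn -> C) : C :=
  (Rintegral (lebesgue_rV n) D (fun x => complex.Re (u x)) +i*
   Rintegral (lebesgue_rV n) D (fun x => complex.Im (u x)))%C.

(* H^s_loc(Om) for s = 0; the values of u outside Om are irrelevant *)
Definition L2loc (Om : set Rn) (u : Rn -> C) :=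
  [/\ measurable_fun Om
        ((fun x => complex.Re (u x)) : Rn -> measurableTypeR R),
      measurable_fun Om
        ((fun x => complex.Im (u x)) : Rn -> measurableTypeR R) &
      forall K : set Rn, compact K -> K `<=` Om ->
        (\int[lebesgue_rV n]_(x in K)
           (complex.Re (u x) ^+ 2 + complex.Im (u x) ^+ 2)%:E < +oo)%E].

(* Distributions are written through the sesquilinear L^2 pairing: T phi stands
   for (T, phi), which is antilinear in the test function phi.  With this
   convention D_k, multiplication by b and the formal adjoint X^* act by
   (D_k T, phi) = (T, D_k phi), (b T, phi) = (T, conj(b) phi) and
   (X^* T, phi) = (T, X phi). *)
Definition distr := (Rn -> C) -> C.

Definition distr_fun (Om : set Rn) (u : Rn -> C) : distr := fun phi =>
  cintegral Om (fun x => u x * (phi x)^*%C).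

Definition distr_D (k : 'I_n) (T : distr) : distr := fun phi => T (Dop k phi).

Definition distr_mul (b : Rn -> C) (T : distr) : distr := fun phi =>
  T (fun x => (b x)^*%C * phi x).

Definition distr_vf (a : Rn -> Rn) (T : distr) : distr := fun phi =>
  \sum_(k < n) distr_mul (fun x => (a x ord0 k)%:C%C) (distr_D k T) phi.

Definition distr_vf_adj (a : Rn -> Rn) (T : distr) : distr := fun phi =>
  T (vf_op a phi).

(* P = sum_(1 <= j <= N) X_j^* f_j X_j + i X_0 + X_(N+1) + a0, where a j holds
   the coefficients of X_j for 0 <= j <= N+1 *)
Definition Pop (N : nat) (a : nat -> Rn -> Rn) (f : nat -> Rn -> R)
    (a0 : Rn -> C) (T : distr) : distr := fun phi =>
  \sum_(1 <= j < N.+1)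
     distr_vf_adj (a j)
       (distr_mul (fun x => (f j x)%:C%C) (distr_vf (a j) T)) phi
  + 'i%C * distr_vf (a 0%N) T phi
  + distr_vf (a N.+1) T phi
  + distr_mul a0 T phi.

(* H^s to H^s' local solvability for s = s' = 0; the equation P u = g in the
   interior of K is the equality of distributions on that open set. *)
Definition L2_locally_solvable (Om : set Rn) (P : distr -> distr) (x0 : Rn) :=
  exists K : set Rn, [/\ compact K, K `<=` Om, interior K x0 &
    forall g, L2loc Om g -> exists2 u, L2loc Om u &
      forall phi, test_fun (interior K) phi ->
        P (distr_fun Om u) phi = distr_fun Om g phi].

End distributions.

(* Main.v *)
Require Import Defs.
From mathcomp Require Import all_boot all_order all_algebra.
From mathcomp Require Import all_classical all_reals all_analysis measurable_realfun.
From mathcomp Require Import complex ring lra.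
Set Implicit Arguments.
Unset Strict Implicit.
Unset Printing Implicit Defensive.
Import Order.TTheory GRing.Theory Num.Theory.
Import numFieldNormedType.Exports.
Local Open Scope classical_set_scope.
Local Open Scope ring_scope.

(* Write Y = i X_0, Z_j = i X_j, Z = i X_(N+1), real vector fields, and pair
   P^* phi with - (Y + div Y / 2) phi.  Since Y commutes with Z_j, integration by
   parts turns the second order part into (Y f_j) |Z_j phi|^2 / 2 >= 0 plus
   O(|phi|^2), the transport part yields |Y phi|^2, and the first order part
   i Z only contributes [Y, Z], which hypothesis (iii) bounds by these two
   terms.  Hence |Y phi|^2 <= C (|P^* phi|^2 + |phi|^2) in L^2 norms.  Near x0 a
   linear function psi has Y psi > 0, and integrating Y psi |phi|^2 by parts gives
   |phi|^2 <= C r (|Y phi|^2 + |phi|^2) for phi supported in the ball of radius r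
   about x0.  For r small, |phi| <= C |P^* phi|.  Minimizing
   |P^* phi|^2 - 2 Re (g, phi) then produces the solution u as the L^2 limit of
   P^* phi_n. *)

(** * Smooth functions and vector fields *)

(** The [f_j] have no sign and the fields [Z_j] may degenerate, so the second order terms are not
    coercive. The only sign available is that of [Y f_j], which appears when a [Y] derivative is
    moved onto [f_j]. This is why the multiplier is built on [Y], and why [Z_j Y u = Y Z_j u]
    matters: [f_j (Z_j u) (Z_j Y u)] is then [f_j] times half the [Y] derivative of [(Z_j u)^2].
    Nothing controls [Z phi], so it must vanish from the identity: [X_(N+1) = - i Z] couples the
    real and imaginary parts of [phi], and the resulting products are antisymmetric, which leaves a
    commutator. The zeroth order errors carry constants of arbitrary size and are beaten only by
    shrinking the support; those constants are therefore fixed on a larger ball before the radius is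
    chosen. All identities are written for the real pair [(u, v)] with [phi = u + i v], pointwise on
    [Om] and up to divergences of compactly supported fields. *)

Section second_derivatives.
Context {R : realType} {V : normedModType R}.
Implicit Types (f : V -> R) (x e : V) (s t : R).

Lemma is_derive_line f x e t : derivable f (x + t *: e) e ->
  is_derive t (1 : R) (fun s : R => f (x + s *: e)) ('D_e f (x + t *: e)).
Proof.
move=> df.
have E : (fun h : R => h^-1 *: (f (x + (h *: (1 : R) + t) *: e) - f (x + t *: e)))
   = (fun h : R => h^-1 *: (f (h *: e + (x + t *: e)) - f (x + t *: e))).
  apply/funext => h; congr (_ *: (f _ - _)).
  by rewrite -[h *: 1]/(h * 1) mulr1 scalerDl addrCA.
apply: DeriveDef; first by rewrite /derivable /= E; exact: df.
by rewrite /derive /= E.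
Qed.

(** The mean value theorem is applied along [e] to the increment in direction [e'], then along [e']
    to the derivative. Only derivatives in these two directions occur, because smoothness is stated
    through partial derivatives. *)
Lemma second_difference f x e e' s : 0 < s ->
  (forall a b, 0 <= a <= s -> 0 <= b <= s ->
     derivable f (x + a *: e + b *: e') e /\
     derivable ('D_e f) (x + a *: e + b *: e') e') ->
  exists a b, [/\ 0 <= a <= s, 0 <= b <= s &
    f (x + s *: e + s *: e') - f (x + s *: e) - f (x + s *: e') + f x =
    s * s * 'D_e' ('D_e f) (x + a *: e + b *: e')].
Proof.
move=> s0 df.
have ss : 0 <= s <= s by rewrite (ltW s0) lexx.
have s00 : 0 <= (0 : R) <= s by rewrite lexx (ltW s0).
pose F (a : R) := f (x + s *: e' + a *: e) - f (x + a *: e).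
have dF a : 0 <= a <= s ->
    is_derive a (1 : R) F ('D_e f (x + s *: e' + a *: e) - 'D_e f (x + a *: e)).
  move=> a0s; apply: is_deriveB.
    apply: is_derive_line; have [+ _] := df _ _ a0s ss.
    by rewrite (addrAC x).
  by apply: is_derive_line; have [+ _] := df _ _ a0s s00; rewrite scale0r addr0.
have [a a0s Fa] : exists2 a, a \in `]0, s[%R & F s - F 0 =
   (fun a => 'D_e f (x + s *: e' + a *: e) - 'D_e f (x + a *: e)) a * (s - 0).
  apply: (@MVT _ _ _ _ _ s0) => [a|].
    by rewrite in_itv => /andP[a0 as_]; apply: dF; rewrite !ltW.
  apply: derivable_within_continuous => a.
  by rewrite in_itv => a0s; have [] := dF a a0s.
have {}a0s : 0 <= a <= s by move: a0s; rewrite in_itv => /andP[? ?]; rewrite !ltW.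
pose G (b : R) := 'D_e f (x + a *: e + b *: e').
have dG b : 0 <= b <= s ->
    is_derive b (1 : R) G ('D_e' ('D_e f) (x + a *: e + b *: e')).
  by move=> b0s; apply: is_derive_line; have [] := df _ _ a0s b0s.
have [b b0s Gb] : exists2 b, b \in `]0, s[%R & G s - G 0 =
   'D_e' ('D_e f) (x + a *: e + b *: e') * (s - 0).
  apply: (@MVT _ _ (fun b => 'D_e' ('D_e f) (x + a *: e + b *: e')) _ _ s0) => [b|].
    by rewrite in_itv => /andP[b0 bs]; apply: dG; rewrite !ltW.
  apply: derivable_within_continuous => b.
  by rewrite in_itv => b0s; have [] := dG b b0s.
exists a, b; split => //.
  by move: b0s; rewrite in_itv => /andP[? ?]; rewrite !ltW.
move: Fa Gb; rewrite /F /G !scale0r !addr0 !subr0.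
rewrite (addrAC x (s *: e') (a *: e)) (addrAC x (s *: e') (s *: e)) => Fa Gb.
rewrite [RHS](_ : _ = s * ('D_e' ('D_e f) (x + a *: e + b *: e') * s)); last by ring.
rewrite -Gb mulrC -Fa; ring.
Qed.

(** Schwarz's theorem. The second difference is symmetric in [e] and [e'], so its two mean value
    expressions equate the mixed derivatives at two points close to [x]; continuity does the
    rest. *)
Lemma derive_comm f x e e' :
  (\forall y \near x, [/\ derivable f y e, derivable f y e',
      derivable ('D_e f) y e' & derivable ('D_e' f) y e]) ->
  {for x, continuous ('D_e' ('D_e f))} -> {for x, continuous ('D_e ('D_e' f))} ->
  'D_e' ('D_e f) x = 'D_e ('D_e' f) x.
Proof.
move=> df c1 c2; apply/eqP; rewrite -subr_eq0 -normr_le0.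
apply/ler_addgt0Pl => eps eps0; rewrite addr0.
have e2 : 0 < eps / 2 by rewrite divr_gt0.
have n1 := cvgr_dist_lt _ _ c1 _ e2; have n2 := cvgr_dist_lt _ _ c2 _ e2.
have /nbhs_ballP[r /= r0 rP] : \forall y \near x,
    [/\ derivable f y e, derivable f y e', derivable ('D_e f) y e' &
      derivable ('D_e' f) y e] /\
    `|'D_e' ('D_e f) x - 'D_e' ('D_e f) y| < eps / 2 /\
    `|'D_e ('D_e' f) x - 'D_e ('D_e' f) y| < eps / 2.
  by apply: filterI => //; apply: filterI; [exact: n1|exact: n2].
(* With [s = r / (2 M)] the whole parallelogram spanned by [s e] and [s e'] stays in the ball of
   radius [r]; the leading 1 keeps [M] positive even for zero directions. *)
pose M := 1 + `|e| + `|e'|.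
have M0 : 0 < M by rewrite ltr_pwDl// addr_ge0.
pose s := r / 2 / M.
have s0 : 0 < s by rewrite !divr_gt0.
have inb a b : 0 <= a <= s -> 0 <= b <= s -> ball x r (x + a *: e + b *: e').
  move=> /andP[a0 as_] /andP[b0 bs].
  rewrite -ball_normE /= -addrA opprD addrA subrr sub0r normrN.
  apply: (le_lt_trans (ler_normD _ _)); rewrite !normrZ !ger0_norm//.
  apply: (@le_lt_trans _ _ (s * M)); last first.
    by rewrite /s divfK ?gt_eqF// gtr_pMr// invf_lt1// ltr1n.
  rewrite /M !mulrDr mulr1 -addrA -[X in X <= _]add0r lerD ?(ltW s0)//.
  by rewrite lerD// ler_wpM2r.
have [a [b [a0 b0 E1]]] := @second_difference f x e e' s s0
  (fun a b ha hb => let: conj (And4 h1 h2 h3 h4) _ := rP _ (inb a b ha hb) in conj h1 h3).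
have [a' [b' [a'0 b'0 E2]]] : exists a b, [/\ 0 <= a <= s, 0 <= b <= s &
    f (x + s *: e' + s *: e) - f (x + s *: e') - f (x + s *: e) + f x =
    s * s * 'D_e ('D_e' f) (x + a *: e' + b *: e)].
  apply: (@second_difference f x e' e s s0) => a' b' ha hb; rewrite (addrAC x).
  have [[_ h2 _ h4] _] := rP _ (inb _ _ hb ha).
  by split; [exact: h2|exact: h4].
move: E2; rewrite (addrAC x (a' *: e')) => E2.
have E : 'D_e' ('D_e f) (x + a *: e + b *: e') = 'D_e ('D_e' f) (x + b' *: e + a' *: e').
  apply: (@mulfI _ (s * s)); first by rewrite mulf_neq0// gt_eqF.
  apply: (etrans (esym E1)); apply: etrans E2.
  by rewrite (addrAC x (s *: e')); ring.
have [_ [{}n1 _]] := rP _ (inb _ _ a0 b0).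
have [_ [_ {}n2]] := rP _ (inb _ _ b'0 a'0).
move: n1 n2; rewrite E; set u := 'D_e _ _; set v := 'D_e' _ x; set w := 'D_e _ x.
move=> n1 n2; rewrite (_ : v - w = (v - u) - (w - u)); last by ring.
apply: (le_trans (ler_normB _ _)).
by rewrite [leRHS]splitr; apply: lerD; apply: ltW; [exact: n1|exact: n2].
Qed.

End second_derivatives.

(** * Calculus of functions smooth on an open set *)

Section smooth_calculus.
Context {R : realType} {n : nat}.
Local Notation Rn := 'rV[R]_n.
Implicit Types (Om K : set Rn) (f g : Rn -> R) (k : 'I_n).

Lemma open_near Om x (P : Rn -> Prop) : open Om -> Om x ->
  (forall y, Om y -> P y) -> \forall y \near x, P y.
Proof.
move=> oOm Omx OP; apply: (filterS OP).
exact: open_nbhs_nbhs.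
Qed.

Lemma eq_partial Om f g k : open Om -> (forall x, Om x -> f x = g x) ->
  forall x, Om x -> partial k f x = partial k g x.
Proof.
by move=> oOm fg x Omx; apply: near_eq_derive; exact: open_near fg.
Qed.

Lemma partial_cst (c : R) k x : partial k (cst c : Rn -> R) x = 0.
Proof. exact: derive_cst. Qed.

Lemma smooth_continuous Om f x : smooth Om f -> Om x -> {for x, continuous f}.
Proof. by move=> sf Omx; have [] := sf [::] x Omx. Qed.

Lemma smooth_derivable Om f x k :
  smooth Om f -> Om x -> derivable f x (delta_mx ord0 k : Rn).
Proof. by move=> sf Omx; have [_] := sf [::] x Omx; apply. Qed.

Lemma smooth_partial Om f k : smooth Om f -> smooth Om (partial k f).
Proof. by move=> sf s; have := sf (rcons s k); rewrite foldr_rcons. Qed.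

Lemma smoothW Om Om' f : Om' `<=` Om -> smooth Om f -> smooth Om' f.
Proof. by move=> sub sf s x /sub; exact: sf. Qed.

(** Since [smooth] quantifies over all iterated derivatives, it suffices to exhibit a class closed
    under [partial]. Products, coordinates and extensions by zero are all treated this way. *)
Lemma smooth_coind Om (P : (Rn -> R) -> Prop) :
  (forall f, P f -> forall x, Om x -> {for x, continuous f} /\
     forall k, derivable f x (delta_mx ord0 k : Rn)) ->
  (forall f k, P f -> P (partial k f)) ->
  forall f, P f -> smooth Om f.
Proof.
move=> P1 P2 f Pf s; suff : P (foldr partial f s) by exact: P1.
by elim: s => //= k s; exact: P2.
Qed.

(* Closing the smooth functions under sums, products and equality on Om gives a
   class stable under partial derivatives; this proves smoothness of products
   without a Leibniz formula for iterated derivatives. *)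
Inductive smooth_alg Om : (Rn -> R) -> Prop :=
| smooth_alg_gen f : smooth Om f -> smooth_alg Om f
| smooth_alg_add f g : smooth_alg Om f -> smooth_alg Om g -> smooth_alg Om (f + g)
| smooth_alg_mul f g : smooth_alg Om f -> smooth_alg Om g -> smooth_alg Om (f * g)
| smooth_alg_eq f g : smooth_alg Om f -> (forall x, Om x -> f x = g x) ->
    smooth_alg Om g.

Section open_set.
Variables (Om : set Rn) (oOm : open Om).

Lemma smooth_algP f : smooth_alg Om f -> smooth Om f.
Proof.
have reg h : smooth_alg Om h -> forall x, Om x -> {for x, continuous h} /\
     forall k, derivable h x (delta_mx ord0 k : Rn).
  elim=> {h} [h sh x|h1 h2 _ IH1 _ IH2 x Omx|h1 h2 _ IH1 _ IH2 x Omx|h1 h2 _ IH h12 x Omx].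
  - exact: (sh [::]).
  - have [c1 d1] := IH1 x Omx; have [c2 d2] := IH2 x Omx; split=> [|k].
      exact: (@continuousD _ _ _ h1 h2).
    exact: derivableD.
  - have [c1 d1] := IH1 x Omx; have [c2 d2] := IH2 x Omx; split=> [|k].
      exact: (@continuousM _ _ h1 h2).
    exact: derivableM.
  - have [c1 d1] := IH x Omx; have nh := open_near oOm Omx h12; split=> [|k].
      rewrite /prop_for /continuous_at -h12//.
      exact: cvg_trans (near_eq_cvg nh) c1.
    by apply: (near_eq_derivable _ (d1 k)); exact: nh.
apply: (@smooth_coind Om (smooth_alg Om)) => // {}f k.
elim=> {f} [h sh|h1 h2 a1 IH1 a2 IH2|h1 h2 a1 IH1 a2 IH2|h1 h2 _ IH h12].
- exact/smooth_alg_gen/smooth_partial.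
- apply: (smooth_alg_eq (smooth_alg_add IH1 IH2)) => x Omx.
  by rewrite /partial deriveD//; [have [] := reg _ a1 x Omx|have [] := reg _ a2 x Omx].
- apply: (smooth_alg_eq (smooth_alg_add (smooth_alg_mul a1 IH2) (smooth_alg_mul a2 IH1))) => x Omx.
  by rewrite /partial deriveM//; [have [] := reg _ a1 x Omx|have [] := reg _ a2 x Omx].
- by apply: (smooth_alg_eq IH) => x Omx; exact: eq_partial h12 _ Omx.
Qed.

Lemma smooth_eq f g : smooth Om f -> (forall x, Om x -> f x = g x) -> smooth Om g.
Proof. by move=> sf fg; apply/smooth_algP/(smooth_alg_eq _ fg)/smooth_alg_gen. Qed.

Lemma smoothD f g : smooth Om f -> smooth Om g -> smooth Om (f + g).
Proof. by move=> ? ?; apply/smooth_algP/smooth_alg_add; exact: smooth_alg_gen. Qed.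

Lemma smoothM f g : smooth Om f -> smooth Om g -> smooth Om (f * g).
Proof. by move=> ? ?; apply/smooth_algP/smooth_alg_mul; exact: smooth_alg_gen. Qed.

Lemma smooth_cst (c : R) : smooth Om (cst c).
Proof.
apply: (@smooth_coind Om (fun f => exists c, f = cst c)); last by exists c.
  move=> _ [d ->] x Omx; split=> [|k]; first exact: cst_continuous.
  exact: derivable_cst.
move=> _ k [d ->]; exists 0; apply/funext => x; exact: derive_cst.
Qed.

Lemma smoothN f : smooth Om f -> smooth Om (- f).
Proof.
move=> sf; apply: (smooth_eq (smoothM (smooth_cst (-1)) sf)) => x _.
exact: mulN1r.
Qed.

Lemma smoothB f g : smooth Om f -> smooth Om g -> smooth Om (f - g).
Proof. by move=> sf sg; exact: smoothD sf (smoothN sg). Qed.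

Lemma smooth_sum (I : Type) (r : seq I) (P : pred I) (F : I -> Rn -> R) :
  (forall i, P i -> smooth Om (F i)) ->
  smooth Om (fun x => \sum_(i <- r | P i) F i x).
Proof.
move=> sF; rewrite (_ : (fun _ => _) = \sum_(i <- r | P i) F i); last first.
  by apply/funext => x; rewrite fct_sumE.
elim/big_rec: _ => [|i h Pi IH]; first exact: smooth_cst.
by apply: smoothD; [exact: sF|exact: IH].
Qed.

Lemma partialD f g k x : smooth Om f -> smooth Om g -> Om x ->
  partial k (f + g) x = partial k f x + partial k g x.
Proof.
move=> sf sg Omx; apply: deriveD.
- exact: smooth_derivable sf Omx.
- exact: smooth_derivable sg Omx.
Qed.

Lemma partialM f g k x : smooth Om f -> smooth Om g -> Om x ->
  partial k (f * g) x = f x * partial k g x + g x * partial k f x.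
Proof. 
move=> sf sg Omx; apply: deriveM.
- exact: smooth_derivable sf Omx.
- exact: smooth_derivable sg Omx.
Qed.

Lemma partial_comm f k l x : smooth Om f -> Om x ->
  partial k (partial l f) x = partial l (partial k f) x.
Proof.
move=> sf Omx.
have sl := smooth_partial l sf; have sk := smooth_partial k sf.
apply: derive_comm.
- apply: (open_near oOm Omx) => y Omy; split.
  + exact: smooth_derivable sf Omy.
  + exact: smooth_derivable sf Omy.
  + exact: smooth_derivable sl Omy.
  + exact: smooth_derivable sk Omy.
- exact: smooth_continuous (smooth_partial k sl) Omx.
- exact: smooth_continuous (smooth_partial l sk) Omx.
Qed.

End open_set.

End smooth_calculus.

(** * Integration by parts *)

Section rV_measure.
Context {R : realType}.
Implicit Types (n : nat).

Lemma rV_ball n (x y : 'rV[R]_n) e : 0 < e ->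
  ball x e y <-> forall i, `|x ord0 i - y ord0 i| < e.
Proof.
move=> e0; split=> [[_ xy] i|xy]; first exact: (xy ord0 i).
by split=> // i j; rewrite ord1; exact: xy.
Qed.

Lemma ler_rV_norm n (x : 'rV[R]_n) i : `|x ord0 i| <= `|x|.
Proof.
have /mapP[j Hj ->] : `|x ord0 i| \in [seq `|x p.1 p.2| | p : 'I_1 * 'I_n].
  by apply/mapP; exists (ord0, i) => //=; rewrite mem_enum.
by rewrite [leRHS]/Num.norm /= mx_normrE; apply/bigmax_geP; right => /=; exists j.
Qed.

Lemma rV_norm_le n (x : 'rV[R]_n) C : 0 <= C ->
  (forall i, `|x ord0 i| <= C) -> `|x| <= C.
Proof.
move=> C0 xC; rewrite [leLHS]/Num.norm /= mx_normrE.
by apply/bigmax_leP; split=> // -[i j] _; rewrite ord1; exact: xC.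
Qed.

Lemma measurable_ball_rV n (x : 'rV[R]_n) e : measurable (ball x e).
Proof.
have [e0|e0] := ltP 0 e; last first.
  rewrite (_ : ball x e = set0) ?measurable0//.
  by apply/seteqP; split=> // y [e0']; rewrite ltNge e0 in e0'.
pose A (i : 'I_n) : set (measurableTypeR R) := [set` `]x ord0 i - e, x ord0 i + e[%R].
rewrite (_ : ball x e = [set y : 'rV[R]_n | forall i, A i (y ord0 i)]).
  by apply: measurable_rV_box => i; exact: measurable_itv.
apply/seteqP; split=> y /=.
  by move/(rV_ball _ _ e0) => xy i; rewrite /A/= in_itv/= -ltr_distlC; exact: xy.
move=> xy; apply/(rV_ball _ _ e0) => i.
by have := xy i; rewrite /A/= in_itv/= -ltr_distlC.
Qed.

(** The sigma-algebra is generated by the coordinates, so openness has to be reduced to boxes: [U]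
    is the countable union of the sup-norm balls contained in it with rational centre and radius
    [1 / (k + 1)]. *)
Lemma open_measurable_rV n (U : set 'rV[R]_n) : open U -> measurable U.
Proof.
move=> oU; pose q (p : 'rV[rat]_n) : 'rV[R]_n := map_mx ratr p.
pose F (p : 'rV[rat]_n * nat) : set 'rV[R]_n :=
  if `[< ball (q p.1) p.2.+1%:R^-1 `<=` U >] then ball (q p.1) p.2.+1%:R^-1 else set0.
rewrite (_ : U = \bigcup_p F p).
  apply: countable_bigcupT_measurable => // p; rewrite /F.
  by case: ifPn => _; [exact: measurable_ball_rV|exact: measurable0].
apply/seteqP; split=> x; last first.
  by move=> [p _]; rewrite /F; case: ifPn => // /asboolP sub /sub.
move=> Ux; have /nbhs_ballP[r /= r0 rU] : nbhs x U by exact: open_nbhs_nbhs.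
have [k] := ltr_add_invr (divr_gt0 r0 (ltr0Sn R 1)); rewrite add0r => kr.
have k0 : (0 : R) < k.+1%:R^-1 by rewrite invr_gt0 ltr0n.
have /choice[c cP] : forall i, exists c : rat,
    ratr c \in `]x ord0 i - k.+1%:R^-1, x ord0 i + k.+1%:R^-1[.
  by move=> i; apply: rat_in_itvoo; rewrite ltrD2l gtrN.
have qx : ball (q (\row_i c i)) k.+1%:R^-1 x.
  apply/rV_ball => // i; rewrite !mxE; have := cP i.
  by rewrite in_itv/= -ltr_distlC distrC.
exists (\row_i c i, k) => //; rewrite /F; case: ifPn => // /asboolP; case=> y qy.
apply: rU; rewrite [r]splitr; apply: ball_triangle.
  by apply: le_ball (ltW kr) _ _; apply: ball_sym; exact: qx.
by apply: le_ball (ltW kr) _ _; exact: qy.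
Qed.

Lemma closed_measurable_rV n (K : set 'rV[R]_n) : closed K -> measurable K.
Proof.
by move=> cK; rewrite -(setCK K); apply: measurableC; apply: open_measurable_rV;
  exact: closed_openC.
Qed.

Lemma compact_closed_rV n (K : set 'rV[R]_n) : compact K -> closed K.
Proof. by apply: compact_closed; exact: norm_hausdorff. Qed.

Lemma compact_measurable_rV n (K : set 'rV[R]_n) : compact K -> measurable K.
Proof. by move=> /compact_closed_rV; exact: closed_measurable_rV. Qed.

Lemma continuous_measurable_rV n (f : 'rV[R]_n -> R) : continuous f ->
  measurable_fun setT (f : 'rV[R]_n -> measurableTypeR R).
Proof.
move=> /continuousP cf; apply: (measurability _ (RGenOpens.measurableE R)).
move=> _ [_ [a [b ->] <-]]; rewrite setTI.
by apply: open_measurable_rV; apply: cf; exact: interval_open.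
Qed.

Lemma lebesgue_rV_bounded n (A : set 'rV[R]_n) (M : R) : measurable A ->
  (forall x, A x -> `|x| <= M) -> (lebesgue_rV n A < +oo)%E.
Proof.
move=> mA AM; pose B (i : 'I_n) : set (measurableTypeR R) := [set` `[- M, M]%R].
have mB i : measurable (B i) by exact: measurable_itv.
apply: (@le_lt_trans _ _ (lebesgue_rV n [set x | forall i, B i (x ord0 i)])).
  apply: le_measure; rewrite ?inE//; first exact: measurable_rV_box.
  move=> x /AM xM i; rewrite /B/= in_itv/= -ler_norml.
  exact: le_trans (ler_rV_norm x i) xM.
rewrite lebesgue_rV_box// -ge0_fin_numE; last by apply: prode_ge0 => i _.
apply: prode_fin_num => i _; rewrite /B lebesgue_measure_itv.
by case: ifPn.
Qed.

(** Compact support with an explicit radius: restrictions to coordinate lines and slices inherit it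
    with the same [M], as the induction on the dimension requires. *)
Definition csupp n (M : R) (f : 'rV[R]_n -> R) := forall x, M < `|x| -> f x = 0.

Lemma closed_norm_ball n (M : R) : closed [set x : 'rV[R]_n | `|x| <= M].
Proof.
rewrite (_ : [set _ | _] = (fun x : 'rV[R]_n => `|x|) @^-1` [set t | t <= M]) //.
apply: closed_comp; last exact: closed_le.
by move=> x _; exact: norm_continuous.
Qed.

Lemma compact_norm_ball n (M : R) : compact [set x : 'rV[R]_n | `|x| <= M].
Proof.
apply: bounded_closed_compact; last exact: closed_norm_ball.
by exists M; split; [exact: num_real|move=> N MN x /= xM; rewrite (le_trans xM)// ltW].
Qed.

Lemma integrable_csupp n (f : 'rV[R]_n -> R) M : continuous f -> csupp M f ->
  (lebesgue_rV n).-integrable setT (EFin \o f).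
Proof.
move=> cf sf; pose K := [set x : 'rV[R]_n | `|x| <= M].
have cK : compact K by exact: compact_norm_ball.
have mK : measurable K by apply: closed_measurable_rV; exact: closed_norm_ball.
have -> : EFin \o f = (EFin \o f) \_ K.
  apply/funext => x; rewrite patchE; case: ifPn => // /negP.
  by rewrite inE /K/= => /negP; rewrite -ltNge => /sf /= ->.
apply/(integrable_restrict (lebesgue_rV n) mK (@measurableT _ _)); rewrite setTI.
apply: measurable_bounded_integrable => //.
- by apply: lebesgue_rV_bounded mK _ => x; exact.
- apply: measurable_funTS; exact: continuous_measurable_rV.
- have /compact_bounded[N [_ NP]] :=
    continuous_compact (continuous_subspaceT cf) cK.
  by exists N; split; rewrite ?num_real // => ? ? ? ?; exact: NP.
Qed.

Lemma near_norm_gt (V : normedModType R) (x : V) M :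
  M < `|x| -> \forall y \near x, M < `|y|.
Proof.
move=> Mx; apply: (@norm_continuous R V x [set t | M < t]).
by apply: open_nbhs_nbhs; split => //; exact: open_gt.
Qed.

Lemma integral_derive_csupp (g : R -> R) M :
  (forall t, derivable g t 1) -> continuous (fun t => 'D_1 g t) ->
  (forall t, M < `|t| -> g t = 0) ->
  (\int[lebesgue_measure]_(t in [set: measurableTypeR R]) ('D_1 g t)%:E = 0)%E.
Proof.
(* The absolute value keeps the interval [[-B, B]] nondegenerate when [M] is negative. *)
move=> dg cdg g0; pose B := `|M| + 1.
have MB : M < B by rewrite (le_lt_trans (ler_norm _))// ltrDl.
have B0 : 0 < B by rewrite ltr_wpDl.
have cg : continuous g.
  by move=> t; apply/differentiable_continuous/derivable1_diffP.
have dg0 t : M < `|t| -> 'D_1 g t = 0.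
  move=> Mt; rewrite -(derive_cst (0 : R) t 1).
  by apply: near_eq_derive; apply: filterS (near_norm_gt Mt) => s /g0.
rewrite (_ : (fun t => ('D_1 g t)%:E) =
    (fun t => ('D_1 g t)%:E) \_ [set` `[- B, B]%R]); last first.
  apply/funext => t; rewrite patchE; case: ifPn => //.
  rewrite notin_setE/= in_itv/= -ler_norml => /negP; rewrite -ltNge => Bt.
  by rewrite dg0// (lt_trans MB).
rewrite -integral_mkcond (@continuous_FTC2 R (fun t => 'D_1 g t) g)//.
- by rewrite !g0 ?subee// ?normrN ger0_norm// ltW.
- by rewrite ltrNl (lt_trans _ B0)// oppr_lt0.
- exact: continuous_subspaceT.
- by split=> [t _||]//; [exact: cvg_at_right_filter (cg _)|exact: cvg_at_left_filter (cg _)].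
- by move=> t _; rewrite derive1E.
Qed.

Lemma cons_rV_eq n (t : R) (v : 'rV[R]_n) :
  cons_rV (t, v) = cons_rV (0, v) + t *: delta_mx ord0 ord0 :> 'rV[R]_n.+1.
Proof.
apply/rowP => i; rewrite [RHS]mxE [X in _ = _ + X]mxE [delta_mx _ _ _ _]mxE.
case: (unliftP ord0 i) => [j|] ->; last by rewrite !cons_rV0 /= mulr1 add0r.
by rewrite !cons_rVS /= mulr0 addr0.
Qed.

Lemma cons_rVDZ n (t s : R) (v : 'rV[R]_n) (k : 'I_n) :
  cons_rV (t, v + s *: delta_mx ord0 k) =
  cons_rV (t, v) + s *: delta_mx ord0 (lift ord0 k) :> 'rV[R]_n.+1.
Proof.
apply/rowP => i; rewrite [RHS]mxE [X in _ = _ + X]mxE [delta_mx _ _ _ _]mxE.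
case: (unliftP ord0 i) => [j|] ->; last by rewrite !cons_rV0 /= mulr0 addr0.
by rewrite !cons_rVS !mxE (inj_eq lift_inj).
Qed.

Lemma cons_rV_continuous n (t : R) : continuous (fun v : 'rV[R]_n => cons_rV (t, v)).
Proof.
move=> v A /nbhs_ballP[e /= e0 eA]; apply/nbhs_ballP; exists e => //= w vw.
apply: eA.
apply/(rV_ball _ _ e0) => i; case: (unliftP ord0 i) => [j|] ->.
  by rewrite !cons_rVS; move: j; apply/(rV_ball _ _ e0).
by rewrite !cons_rV0 subrr normr0.
Qed.

Lemma derivable_slice n (f : 'rV[R]_n.+1 -> R) (t : R) (v : 'rV[R]_n) (k : 'I_n) :
  derivable f (cons_rV (t, v)) (delta_mx ord0 (lift ord0 k)) ->
  is_derive v (delta_mx ord0 k) (fun w => f (cons_rV (t, w)))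
    (partial (lift ord0 k) f (cons_rV (t, v))).
Proof.
move=> df; have E : (fun h : R => h^-1 *:
     (f (cons_rV (t, h *: delta_mx ord0 k + v)) - f (cons_rV (t, v)))) =
   (fun h => h^-1 *: (f (h *: delta_mx ord0 (lift ord0 k) + cons_rV (t, v)) -
      f (cons_rV (t, v)))).
  apply/funext => h; rewrite (addrC (h *: delta_mx ord0 k)) cons_rVDZ.
  by rewrite (addrC (h *: delta_mx ord0 (lift ord0 k))).
apply: DeriveDef; first by rewrite /derivable /= E; exact: df.
by rewrite /partial /derive /= E.
Qed.

(** Induction on the dimension through Fubini on [R * R^n]. For the first coordinate the inner
    integral in that variable vanishes by the fundamental theorem of calculus; for any other
    coordinate the inner integral over the slice vanishes by induction. *)
Lemma integral_partial n (k : 'I_n) (f : 'rV[R]_n -> R) M :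
  (forall x, derivable f x (delta_mx ord0 k)) -> continuous (partial k f) ->
  continuous f -> csupp M f ->
  (\int[lebesgue_rV n]_x (partial k f x)%:E = 0)%E.
Proof.
elim: n k f => [[]//|n IH] k f df cdf cf f0.
have df0 : csupp M (partial k f).
  move=> x Mx; rewrite /partial -(derive_cst (0 : R) x (delta_mx ord0 k)).
  by apply: near_eq_derive; apply: filterS (near_norm_gt Mx) => y /f0.
have idf := integrable_csupp cdf df0; have mdf := measurable_int _ idf.
have icf : (lebesgue_measure \x lebesgue_rV n)%E.-integrable setT
    ((EFin \o partial k f) \o @cons_rV R n).
  apply/integrableP; split.
    exact: (measurableT_comp mdf (@measurable_cons_rV R n)).
  have /integrableP[_] := idf; apply: le_lt_trans.
  rewrite [X in (_ <= X)%E](@ge0_integral_pushforward _ _ _ _ _ (@cons_rV R n)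
    (@measurable_cons_rV R n) (lebesgue_measure \x lebesgue_rV n)%E)//.
  by apply: measurableT_comp.
transitivity (\int[(lebesgue_measure \x lebesgue_rV n)%E]_p
    ((EFin \o partial k f) \o @cons_rV R n) p)%E.
  exact: (@integral_pushforward _ _ _ _ _ (@cons_rV R n)
    (@measurable_cons_rV R n) (lebesgue_measure \x lebesgue_rV n)%E).
have normc (t : R) (v : 'rV[R]_n) : `|t| <= `|cons_rV (t, v) : 'rV[R]_n.+1|.
  by have := ler_rV_norm (cons_rV (t, v)) ord0; rewrite cons_rV0.
case: (unliftP ord0 k) => [j|] kE; subst k.
  rewrite -integral12_prod_meas1//; apply: integral0_eq => t _.
  rewrite /fubini_F /=.
  have dfs v := derivable_slice (df (cons_rV (t, v))).
  have E v : partial j (fun w => f (cons_rV (t, w))) v =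
      partial (lift ord0 j) f (cons_rV (t, v)).
    by rewrite {1}/partial; exact: (@derive_val _ _ _ _ _ _ _ (dfs v)).
  under eq_integral do rewrite -E.
  apply: IH.
  - by move=> v; have [] := dfs v.
  - rewrite (_ : partial j _ = (partial (lift ord0 j) f) \o (fun v => cons_rV (t, v))).
      by move=> v; apply: continuous_comp; [exact: cons_rV_continuous|exact: cdf].
    by apply/funext => v; exact: E.
  - by move=> v; apply: continuous_comp; [exact: cons_rV_continuous|exact: cf].
  - move=> v Mv; apply: f0; apply: (lt_le_trans Mv).
    apply: rV_norm_le => // i.
    by have := ler_rV_norm (cons_rV (t, v)) (lift ord0 i); rewrite cons_rVS.
rewrite -integral21_prod_meas1//; apply: integral0_eq => v _.
rewrite /fubini_G /=.
have E0 (t : R) : f (cons_rV (t, v)) = f (cons_rV (0, v) + t *: delta_mx ord0 ord0).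
  by rewrite cons_rV_eq.
pose g (t : R) := f (cons_rV (0, v) + t *: delta_mx ord0 ord0).
have dg t := is_derive_line (df (cons_rV (0, v) + t *: delta_mx ord0 ord0)).
have E (t : R) : 'D_1 g t = partial ord0 f (cons_rV (t, v)).
  by rewrite (@derive_val _ _ _ _ _ _ _ (dg t)) (cons_rV_eq t).
under eq_integral do rewrite -E.
apply: (@integral_derive_csupp g M).
- by move=> t; have [] := dg t.
- have -> : (fun t => 'D_1 g t) = partial ord0 f \o
      (fun t : R => cons_rV (0, v) + t *: delta_mx ord0 ord0).
    by apply/funext => t /=; rewrite E (cons_rV_eq t).
  move=> t; apply: continuous_comp; last exact: cdf.
  by apply: cvgD; [exact: cvg_cst|exact: scalel_continuous].
- by move=> t Mt; rewrite /g -(cons_rV_eq t); apply: f0; exact: lt_le_trans (normc t v).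
Qed.

End rV_measure.

(* Unification would otherwise unfold these down to filters and limits. *)
Local Opaque partial smooth.

(** * Real vector fields, their divergence, and test functions *)

Section vector_fields.
Context {R : realType} {n : nat}.
Local Notation Rn := 'rV[R]_n.
Implicit Types (Om K : set Rn) (f g h : Rn -> R) (b y z : Rn -> Rn) (k : 'I_n).

Definition smooth_vf Om b := forall k : 'I_n, smooth Om (fun x => b x ord0 k).

Definition dv b : Rn -> R :=
  fun x => \sum_(k < n) partial k (fun p => b p ord0 k) x.

Section rules.
Variables (Om : set Rn) (oOm : open Om).

Lemma partial_sum (I : Type) (r : seq I) (F : I -> Rn -> R) k x :
  (forall i, smooth Om (F i)) -> Om x ->
  partial k (fun p => \sum_(i <- r) F i p) x = \sum_(i <- r) partial k (F i) x.
Proof.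
move=> sF Omx; rewrite (_ : (fun _ => _) = \sum_(i <- r) F i); last first.
  by apply/funext => p; rewrite fct_sumE.
elim: r => [|i r IH]; first by rewrite !big_nil; exact: partial_cst.
rewrite !big_cons -IH; apply: (@partialD _ _ Om) => //.
rewrite (_ : \sum_(j <- r) F j = fun p => \sum_(j <- r) F j p).
  by apply: (smooth_sum oOm) => j _; exact: sF.
by apply/funext => p; rewrite fct_sumE.
Qed.

Lemma smooth_ivf b f : smooth_vf Om b -> smooth Om f -> smooth Om (ivf b f).
Proof.
move=> sb sf; apply: (smooth_sum oOm) => k _.
exact: (smoothM oOm (sb k) (smooth_partial k sf)).
Qed.

Lemma smooth_dv b : smooth_vf Om b -> smooth Om (dv b).
Proof.
by move=> sb; apply: (smooth_sum oOm) => k _; exact: smooth_partial k (sb k).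
Qed.

Lemma ivfD b f g x : smooth Om f -> smooth Om g -> Om x ->
  ivf b (f + g) x = ivf b f x + ivf b g x.
Proof.
move=> sf sg Omx; rewrite /ivf -big_split; apply: eq_bigr => k _ /=.
by rewrite (partialD _ sf sg Omx) mulrDr.
Qed.

Lemma ivfM b f g x : smooth Om f -> smooth Om g -> Om x ->
  ivf b (f * g) x = f x * ivf b g x + g x * ivf b f x.
Proof.
move=> sf sg Omx; rewrite /ivf !mulr_sumr -big_split; apply: eq_bigr => k _ /=.
by rewrite (partialM _ sf sg Omx) mulrDr mulrCA (mulrCA (g x)).
Qed.

Lemma ivf_cst b (c : R) x : ivf b (cst c) x = 0.
Proof.
by rewrite /ivf big1// => k _; rewrite partial_cst mulr0.
Qed.

Lemma ivfN b f x : smooth Om f -> Om x -> ivf b (- f) x = - ivf b f x.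
Proof.
move=> sf Omx; have /= := ivfD b sf (smoothN oOm sf) Omx.
by rewrite subrr [ivf b 0 x]ivf_cst => /esym/eqP; rewrite addrC addr_eq0 => /eqP.
Qed.

Lemma ivfB b f g x : smooth Om f -> smooth Om g -> Om x ->
  ivf b (f - g) x = ivf b f x - ivf b g x.
Proof.
by move=> sf sg Omx; rewrite (ivfD _ sf (smoothN oOm sg) Omx) (ivfN _ sg Omx).
Qed.

Lemma div_vf b f x : smooth_vf Om b -> smooth Om f -> Om x ->
  \sum_(k < n) partial k ((fun p => b p ord0 k) * f) x = ivf b f x + dv b x * f x.
Proof.
move=> sb sf Omx; rewrite /ivf /dv mulr_suml -big_split; apply: eq_bigr => k _ /=.
by rewrite (partialM _ (sb k) sf Omx) (mulrC (f x)).
Qed.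

(** The second order parts of both compositions are the same double sum, by symmetry of second
    derivatives. The coefficients that remain are those of the field [[y, z]], in the form in which
    [poissonE] finds them in the Poisson bracket. *)
Lemma ivf_bracket y z f x : smooth_vf Om y -> smooth_vf Om z -> smooth Om f ->
  Om x -> ivf y (ivf z f) x - ivf z (ivf y f) x =
  \sum_(l < n) (ivf y (fun p => z p ord0 l) x - ivf z (fun p => y p ord0 l) x) *
     partial l f x.
Proof.
move=> sy sz sf Omx.
pose H (b c : Rn -> Rn) :=
  \sum_(k < n) \sum_(l < n) b x ord0 k * c x ord0 l * partial k (partial l f) x.
have HC : H y z = H z y.
  rewrite /H exchange_big /=; apply: eq_bigr => l _; apply: eq_bigr => k _.
  by rewrite (partial_comm oOm k l sf Omx) (mulrC (y x ord0 k)).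
have E (b c : Rn -> Rn) : smooth_vf Om c -> ivf b (ivf c f) x =
    \sum_(l < n) ivf b (fun p => c p ord0 l) x * partial l f x + H b c.
  move=> sc; have sF l : smooth Om (fun p => c p ord0 l * partial l f p).
    exact: (smoothM oOm (sc l) (smooth_partial l sf)).
  transitivity (\sum_(k < n) \sum_(l < n)
      (b x ord0 k * partial k (fun p => c p ord0 l) x * partial l f x +
       b x ord0 k * c x ord0 l * partial k (partial l f) x)).
    apply: eq_bigr => k _.
    rewrite [partial k _ x](partial_sum _ _ sF Omx) mulr_sumr.
    apply: eq_bigr => l _.
    rewrite [X in _ * X](partialM _ (sc l) (smooth_partial l sf) Omx).
    ring.
  under eq_bigr do rewrite big_split /=.
  rewrite big_split /=; congr (_ + _).
  by rewrite exchange_big /=; apply: eq_bigr => l _; rewrite /ivf mulr_suml.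
rewrite (E y z sz) (E z y sy) HC opprD addrACA subrr addr0 -sumrB.
by apply: eq_bigr => l _; rewrite mulrBl.
Qed.

End rules.

(* The coefficients of P are unconstrained outside Om, hence smoothness on Om
   only; for K closed and contained in Om such an f is smooth everywhere. *)
Definition ctest Om K f := smooth Om f /\ forall x, ~ K x -> f x = 0.

Section test_rules.
Variables (Om K : set Rn) (oOm : open Om) (cK : closed K) (KOm : K `<=` Om).

Lemma near_offK x : ~ K x -> \forall y \near x, ~ K y.
Proof. by move=> nKx; apply: (open_near (closed_openC cK)). Qed.

Lemma ctest_partial f k : ctest Om K f -> ctest Om K (partial k f).
Proof.
move=> [sf f0]; split; first exact: smooth_partial.
move=> x nKx; rewrite -(partial_cst 0 k x).
by apply: (eq_partial k (closed_openC cK)) nKx => y; exact: f0.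
Qed.

Lemma ctestM f g : smooth Om f -> ctest Om K g -> ctest Om K (f * g).
Proof.
move=> sf [sg g0]; split; first exact: (smoothM oOm sf sg).
by move=> x nKx; rewrite mulrfctE g0// mulr0.
Qed.

Lemma ctestD f g : ctest Om K f -> ctest Om K g -> ctest Om K (f + g).
Proof.
move=> [sf f0] [sg g0]; split; first exact: (smoothD oOm sf sg).
by move=> x nKx; rewrite addrfctE f0// g0// addr0.
Qed.

Lemma ctestN f : ctest Om K f -> ctest Om K (- f).
Proof.
move=> [sf f0]; split; first exact: (smoothN oOm sf).
by move=> x nKx; rewrite opprfctE f0// oppr0.
Qed.

Lemma ctestB f g : ctest Om K f -> ctest Om K g -> ctest Om K (f - g).
Proof. by move=> tf tg; apply: ctestD => //; exact: ctestN. Qed.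

Lemma ctest_sum (I : Type) (r : seq I) (P : pred I) (F : I -> Rn -> R) :
  (forall i, P i -> ctest Om K (F i)) ->
  ctest Om K (fun x => \sum_(i <- r | P i) F i x).
Proof.
move=> tF; split; first by apply: (smooth_sum oOm) => i /tF[].
by move=> x nKx; rewrite big1// => i /tF[_ ->].
Qed.

Lemma ctest_ivf b f : smooth_vf Om b -> ctest Om K f -> ctest Om K (ivf b f).
Proof.
move=> sb tf; apply: ctest_sum => k _.
by apply: (@ctestM (fun x => b x ord0 k) (partial k f) (sb k)); exact: ctest_partial.
Qed.

(** A point outside [Om] lies off the closed set [K], hence has a neighbourhood on which [f]
    vanishes identically. The class [ctest] is stable under [partial], so [smooth_coind] applies. *)
Lemma ctest_smoothT f : ctest Om K f -> smooth setT f.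
Proof.
apply: (@smooth_coind _ _ setT (ctest Om K)); last by move=> {}f k; exact: ctest_partial.
move=> {}f [sf f0] x _; have [Omx|nOmx] := pselect (Om x); first by split=> [|k];
    [exact: smooth_continuous sf Omx|exact: smooth_derivable sf Omx].
have n0 : \forall y \near x, cst (0 : R) y = f y.
  by apply: filterS (near_offK (fun Kx => nOmx (KOm Kx))) => y /f0.
split=> [|k]; last by apply: (near_eq_derivable n0); exact: derivable_cst.
rewrite /prop_for /continuous_at (_ : f x = 0); last by apply: f0 => /KOm.
exact: (cvg_trans (near_eq_cvg n0) (cvg_cst _)).
Qed.

End test_rules.

End vector_fields.

(** * Divergence theorem for test functions *)

Section test_integrals.
Context {R : realType} {n : nat}.
Local Notation Rn := 'rV[R]_n.
Implicit Types (f g h : Rn -> R) (b : Rn -> Rn) (c : R).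
Variables (Om K : set Rn) (oOm : open Om) (cK : compact K) (KOm : K `<=` Om).

Definition integ h : R := Rintegral (lebesgue_rV n) setT h.

(* div (h b) *)
Definition divv b h : Rn -> R := fun x => ivf b h x + dv b x * h x.

Let clK : closed K := compact_closed_rV cK.

Lemma ctest_csupp h : ctest Om K h -> exists M, csupp M h.
Proof.
move=> [_ h0]; have [M [_ MK]] := compact_bounded cK.
exists (M + 1) => x Mx; apply: h0 => Kx.
have MM : M < M + 1 by rewrite ltrDl.
by have := MK (M + 1) MM x Kx; rewrite /= leNgt Mx.
Qed.

Lemma ctest_continuous h : ctest Om K h -> continuous h.
Proof.
by move=> /(ctest_smoothT clK KOm) sh x; exact: smooth_continuous sh I.
Qed.

Lemma ctest_integrable h : ctest Om K h ->
  (lebesgue_rV n).-integrable setT (EFin \o h).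
Proof.
move=> th; have [M sM] := ctest_csupp th.
exact: integrable_csupp (ctest_continuous th) sM.
Qed.

Lemma integD f g : ctest Om K f -> ctest Om K g ->
  integ (f + g) = integ f + integ g.
Proof. by move=> tf tg; apply: RintegralD => //; exact: ctest_integrable. Qed.

Lemma integZ c f : ctest Om K f -> integ (cst c * f) = c * integ f.
Proof. by move=> tf; apply: RintegralZl => //; exact: ctest_integrable. Qed.

Lemma integ_le f g : ctest Om K f -> ctest Om K g ->
  (forall x, K x -> f x <= g x) -> integ f <= integ g.
Proof.
move=> tf tg fg; apply: le_Rintegral => //; try exact: ctest_integrable.
move=> x _; have [/fg//|nKx] := pselect (K x).
by have [_ ->] := tf => //; have [_ ->] := tg.
Qed.

Lemma integ_partial f k : ctest Om K f -> integ (partial k f) = 0.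
Proof.
move=> tf; have [M sM] := ctest_csupp tf; rewrite /integ /Rintegral.
rewrite (@integral_partial _ _ k f M)//.
- move=> x; exact: smooth_derivable (ctest_smoothT clK KOm tf) I.
- exact/ctest_continuous/ctest_partial.
- exact: ctest_continuous.
Qed.

Lemma ctest0 : ctest Om K (cst 0).
Proof. by split => //; exact: smooth_cst. Qed.

Lemma integ_sum (I : Type) (r : seq I) (F : I -> Rn -> R) :
  (forall i, ctest Om K (F i)) ->
  integ (fun x => \sum_(i <- r) F i x) = \sum_(i <- r) integ (F i).
Proof.
move=> tF; elim: r => [|i r IH].
  rewrite big_nil (_ : (fun _ => _) = cst 0 * cst 0).
    by rewrite (integZ 0 ctest0) mul0r.
  by apply/funext => x; rewrite big_nil fctE /= mul0r.
rewrite big_cons -IH -integD//; last by apply: ctest_sum => // j _; exact: tF.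
by congr integ; apply/funext => x; rewrite big_cons.
Qed.

Lemma ctest_divv b h : smooth_vf Om b -> ctest Om K h -> ctest Om K (divv b h).
Proof.
move=> sb th.
exact: (ctestD oOm (ctest_ivf oOm clK sb th) (ctestM oOm (smooth_dv oOm sb) th)).
Qed.

(** The expansion of the divergence into [partial k] of [b_k h] is available only on [Om], where [b]
    is smooth; off [K] both sides vanish, so the equality holds everywhere and each derivative
    integrates to zero. *)
Lemma integ_divv b h : smooth_vf Om b -> ctest Om K h -> integ (divv b h) = 0.
Proof.
move=> sb th; have tk k : ctest Om K ((fun p => b p ord0 k) * h).
  exact: ctestM (sb k) th.
transitivity (integ (fun x => \sum_(k < n) partial k ((fun p => b p ord0 k) * h) x)).
  congr integ; apply/funext => x; have [Kx|nKx] := pselect (K x).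
    by rewrite (div_vf sb th.1 (KOm Kx)).
  rewrite (ctest_divv sb th).2// big1// => k _.
  exact: (ctest_partial clK k (tk k)).2.
rewrite integ_sum => [|k]; last exact: ctest_partial.
by rewrite big1// => k _; exact: integ_partial.
Qed.

(** Allows integrations by parts to be recorded as pointwise equalities modulo such functions, so
    that one integration at the very end suffices. *)
Definition null_test h := ctest Om K h /\ integ h = 0.

Lemma null_divv b h : smooth_vf Om b -> ctest Om K h -> null_test (divv b h).
Proof. by move=> sb th; split; [exact: ctest_divv|exact: integ_divv]. Qed.

Lemma nullD f g : null_test f -> null_test g -> null_test (f + g).
Proof.
move=> [tf f0] [tg g0]; split; first exact: ctestD.
by rewrite integD// f0 g0 addr0.
Qed.

Lemma nullZ c f : null_test f -> null_test (cst c * f).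
Proof.
move=> [tf f0]; split; last by rewrite integZ// f0 mulr0.
by apply: ctestM => //; exact: smooth_cst.
Qed.

Lemma null_sum (I : Type) (r : seq I) (F : I -> Rn -> R) :
  (forall i, null_test (F i)) -> null_test (fun x => \sum_(i <- r) F i x).
Proof.
move=> nF; split; first by apply: ctest_sum => // i _; have [] := nF i.
by rewrite integ_sum => [|i]; [rewrite big1// => i _|]; have [] := nF i.
Qed.

End test_integrals.

(** * The a priori estimate *)

Section energy_identity.
Context {R : realType} {n : nat}.
Local Notation Rn := 'rV[R]_n.
Variables (Om K : set Rn) (oOm : open Om) (cK : compact K) (KOm : K `<=` Om).
Variables (N : nat) (a : nat -> Rn -> Rn) (f : nat -> Rn -> R) (al be : Rn -> R).
Let y := a 0.
Let z := a N.+1.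
Hypothesis sa : forall j, (j <= N.+1)%N -> smooth_vf Om (a j).
Hypothesis sf : forall j, (1 <= j <= N)%N -> smooth Om (f j).
Hypothesis sal : smooth Om al.
Hypothesis sbe : smooth Om be.
Hypothesis comm : forall j, (1 <= j <= N)%N -> forall u, smooth Om u ->
  forall x, Om x -> ivf y (ivf (a j) u) x = ivf (a j) (ivf y u) x.

Let sy : smooth_vf Om y. Proof. exact: sa. Qed.
Let sz : smooth_vf Om z. Proof. exact: sa. Qed.
Let clK : closed K := compact_closed_rV cK.

(* For phi = u + i v and a0 = al + i be, the formal adjoint satisfies
   P^* phi = adjoint_part u v + i adjoint_part v (- u). *)
Definition adjoint_part (u v : Rn -> R) : Rn -> R := fun x =>
  - (\sum_(1 <= j < N.+1) divv (a j) (f j * ivf (a j) u) x)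
  - divv y u x + divv z v x + al x * u x + be x * v x.

(* - 4 (Y + div Y / 2) u with Y = i X_0.  The skew-adjoint combination is what
   cancels the terms f_j (div Y) |Z_j u|^2, which have no sign. *)
Definition multiplier (u : Rn -> R) : Rn -> R := - (cst 4 * ivf y u + cst 2 * (dv y * u)).

Lemma ctest_multiplier u : ctest Om K u -> ctest Om K (multiplier u).
Proof.
move=> tu; apply: (ctestN oOm); apply: (ctestD oOm).
  exact: (ctestM oOm (smooth_cst _) (ctest_ivf oOm clK sy tu)).
apply: (ctestM oOm (smooth_cst _)).
exact: (ctestM oOm (smooth_dv oOm sy) tu).
Qed.

Lemma divv_smooth b u : smooth_vf Om b -> smooth Om u -> smooth Om (divv b u).
Proof.
move=> sb su.
exact: (smoothD oOm (smooth_ivf oOm sb su) (smoothM oOm (smooth_dv oOm sb) su)).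
Qed.

Lemma ctest_adjoint_part u v : ctest Om K u -> ctest Om K v ->
  ctest Om K (adjoint_part u v).
Proof.
move=> tu tv.
have tS : ctest Om K (fun x => \sum_(1 <= j < N.+1) divv (a j) (f j * ivf (a j) u) x).
  rewrite (_ : (fun _ => _) = fun x =>
     \sum_(1 <= j < N.+1 | (1 <= j <= N)%N) divv (a j) (f j * ivf (a j) u) x).
    apply: (ctest_sum oOm) => j j1N; have saj : smooth_vf Om (a j).
      by apply: sa; case/andP: j1N => _ /leqW.
    apply: (ctest_divv oOm cK saj).
    exact: (ctestM oOm (sf j1N) (ctest_ivf oOm clK saj tu)).
  apply/funext => x; rewrite big_nat_cond [RHS]big_nat_cond; apply: eq_bigl => j.
  by rewrite ltnS andbT andbb.
apply: (ctestD oOm _ (ctestM oOm sbe tv)).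
apply: (ctestD oOm _ (ctestM oOm sal tu)).
apply: (ctestD oOm _ (ctest_divv oOm cK sz tv)).
exact: (ctestB oOm (ctestN oOm tS) (ctest_divv oOm cK sy tu)).
Qed.

Let mulE (p q : Rn -> R) x : (p * q) x = p x * q x. Proof. by []. Qed.
Let addE (p q : Rn -> R) x : (p + q) x = p x + q x. Proof. by []. Qed.
Let oppE (p : Rn -> R) x : (- p) x = - p x. Proof. by []. Qed.
Let cstE (c : R) (x : Rn) : cst c x = c. Proof. by []. Qed.
Let fE := (mulE, addE, oppE, cstE).

Lemma ivfZ b c u x : smooth Om u -> Om x -> ivf b (cst c * u) x = c * ivf b u x.
Proof.
move=> su Omx.
by rewrite (ivfM b (smooth_cst c) su Omx) ivf_cst mulr0 addr0.
Qed.

(** Zeroth order remainder produced when [Z_j] differentiates the [div Y] in the multiplier: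
    [2 f_j (Z_j div Y) u (Z_j u)] equals [f_j (Z_j div Y) Z_j (u^2)], integrated by parts once
    more. *)
Definition second_order_coef j := divv (a j) (f j * ivf (a j) (dv y)).

(** One integration by parts moves [Z_j] onto the multiplier. By commutation
    [- 4 f_j (Z_j u) (Z_j Y u)] is [- 2 f_j Y ((Z_j u)^2)]; a second integration by parts gives
    [2 (Y f_j) (Z_j u)^2] and [2 f_j (div Y) (Z_j u)^2], the latter cancelled by the [div Y] part of
    the multiplier. *)
Lemma second_order_identity j u x : (1 <= j <= N)%N -> smooth Om u -> Om x ->
  - divv (a j) (f j * ivf (a j) u) x * multiplier u x =
  2 * ivf y (f j) x * ivf (a j) u x ^+ 2 + second_order_coef j x * u x ^+ 2
  - divv (a j) (f j * ivf (a j) u * multiplier u) x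
  - 2 * divv y (f j * (ivf (a j) u * ivf (a j) u)) x
  - divv (a j) (f j * ivf (a j) (dv y) * (u * u)) x.
Proof.
move=> jN su Omx; set b := a j; set g := f j.
have sb : smooth_vf Om b by apply: sa; case/andP: jN => _ /leqW.
have sg : smooth Om g by exact: sf.
have sd := smooth_dv oOm sy.
have sbu := smooth_ivf oOm sb su.
have syu := smooth_ivf oOm sy su.
have sdu := smoothM oOm sd su.
have s4 := smoothM oOm (smooth_cst 4) syu.
have s2 := smoothM oOm (smooth_cst 2) sdu.
have sM : smooth Om (multiplier u) by exact: (smoothN oOm (smoothD oOm s4 s2)).
have sgb := smoothM oOm sg sbu.
have sbd := smooth_ivf oOm sb sd.
have E1 : ivf b (multiplier u) x =
    - (4 * ivf b (ivf y u) x + 2 * (dv y x * ivf b u x + u x * ivf b (dv y) x)).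
  rewrite (ivfN oOm b (smoothD oOm s4 s2) Omx) (ivfD b s4 s2 Omx).
  by rewrite (ivfZ b 4 syu Omx) (ivfZ b 2 sdu Omx) (ivfM b sd su Omx).
rewrite /second_order_coef /divv -/b -/g.
rewrite (ivfM b sgb sM Omx) E1 (ivfM y sg (smoothM oOm sbu sbu) Omx).
rewrite (ivfM y sbu sbu Omx) (comm jN su Omx) -/b.
rewrite (ivfM b (smoothM oOm sg sbd) (smoothM oOm su su) Omx).
rewrite (ivfM b su su Omx).
have Mu : multiplier u x = - (4 * ivf y u x + 2 * (dv y x * u x)) by [].
rewrite !fE !Mu.
move: (u x) (g x) (dv b x) (dv y x) (ivf y g x) (ivf y u x) (ivf b u x)
  (ivf b (dv y) x) (ivf b (ivf y u) x) (ivf b (g * ivf b (dv y)) x)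
  (ivf b (g * ivf b u) x) => *.
ring.
Qed.

Definition bracket (u : Rn -> R) : Rn -> R := ivf y (ivf z u) - ivf z (ivf y u).

(** The products of two derivatives form the antisymmetric expression [4 (Z u Y v - Z v Y u)].
    Integrating by parts once along [Z] and once along [Y] removes every derivative from [u] and
    leaves [4 u [Y, Z] v]. *)
Lemma first_order_identity u v x : smooth Om u -> smooth Om v -> Om x ->
  divv z v x * multiplier u x - divv z u x * multiplier v x =
  4 * u x * bracket v x - 4 * dv z x * v x * ivf y u x
  - 2 * (ivf z (dv y) x + dv z x * dv y x) * (u x * v x)
  + 4 * divv z (u * ivf y v) x - 4 * divv y (u * ivf z v) x
  + 2 * divv z (dv y * (u * v)) x.
Proof.
move=> su sv Omx; have sd := smooth_dv oOm sy.
have syv := smooth_ivf oOm sy sv; have szv := smooth_ivf oOm sz sv.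
rewrite /divv (ivfM z su syv Omx) (ivfM y su szv Omx).
rewrite (ivfM z sd (smoothM oOm su sv) Omx) (ivfM z su sv Omx).
rewrite /bracket /multiplier !fE.
move: (u x) (v x) (dv z x) (dv y x) (ivf y u x) (ivf y v x) (ivf z u x) (ivf z v x)
  (ivf z (dv y) x) (ivf y (ivf z v) x) (ivf z (ivf y v) x) => *.
ring.
Qed.

(* Here Z_j = i X_j, Z = i X_(N+1); D gathers all the divergences. *)
Lemma energy_identity u v : ctest Om K u -> ctest Om K v ->
  exists2 D, null_test Om K D & forall x, Om x ->
  adjoint_part u v x * multiplier u x + adjoint_part v (- u) x * multiplier v x =
  2 * (\sum_(1 <= j < N.+1) ivf y (f j) x * ivf (a j) u x ^+ 2)
  + 2 * (\sum_(1 <= j < N.+1) ivf y (f j) x * ivf (a j) v x ^+ 2)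
  + (\sum_(1 <= j < N.+1) second_order_coef j x) * (u x ^+ 2 + v x ^+ 2)
  + 4 * ivf y u x ^+ 2 + 4 * ivf y v x ^+ 2
  + 6 * dv y x * (u x * ivf y u x + v x * ivf y v x)
  + 2 * dv y x ^+ 2 * (u x ^+ 2 + v x ^+ 2)
  + 4 * u x * bracket v x - 4 * dv z x * v x * ivf y u x
  - 2 * (ivf z (dv y) x + dv z x * dv y x) * (u x * v x)
  - 4 * (al x * u x + be x * v x) * ivf y u x
  - 4 * (al x * v x - be x * u x) * ivf y v x
  - 2 * dv y x * al x * (u x ^+ 2 + v x ^+ 2) + D x.
Proof.
move=> tu tv.
have ty w : ctest Om K w -> ctest Om K (ivf y w) by exact: (ctest_ivf oOm clK sy).
have tz w : ctest Om K w -> ctest Om K (ivf z w) by exact: (ctest_ivf oOm clK sz).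
pose D1 w j : Rn -> R := cst (-1) * divv (a j) (f j * ivf (a j) w * multiplier w)
  + cst (-2) * divv y (f j * (ivf (a j) w * ivf (a j) w))
  + cst (-1) * divv (a j) (f j * ivf (a j) (dv y) * (w * w)).
have nD1 w j : ctest Om K w -> (1 <= j <= N)%N -> null_test Om K (D1 w j).
  move=> tw jN; have sb : smooth_vf Om (a j) by apply: sa; case/andP: jN => _ /leqW.
  have sg : smooth Om (f j) by exact: sf.
  have tb := ctest_ivf oOm clK sb tw.
  apply: (nullD oOm cK KOm); last first.
    apply: (nullZ oOm cK KOm); apply: (null_divv oOm cK KOm sb).
    apply: (ctestM oOm _ (ctestM oOm tw.1 tw)).
    exact: (smoothM oOm sg (smooth_ivf oOm sb (smooth_dv oOm sy))).
  apply: (nullD oOm cK KOm).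
    apply: (nullZ oOm cK KOm); apply: (null_divv oOm cK KOm sb).
    exact: (ctestM oOm (smoothM oOm sg tb.1) (ctest_multiplier tw)).
  apply: (nullZ oOm cK KOm); apply: (null_divv oOm cK KOm sy).
  exact: (ctestM oOm sg (ctestM oOm tb.1 tb)).
pose D2 : Rn -> R := cst 4 * divv z (u * ivf y v) + cst (-4) * divv y (u * ivf z v)
  + cst 2 * divv z (dv y * (u * v)).
have nD2 : null_test Om K D2.
  apply: (nullD oOm cK KOm); last first.
    apply: (nullZ oOm cK KOm); apply: (null_divv oOm cK KOm sz).
    exact: (ctestM oOm (smooth_dv oOm sy) (ctestM oOm tu.1 tv)).
  apply: (nullD oOm cK KOm).
    apply: (nullZ oOm cK KOm); apply: (null_divv oOm cK KOm sz).
    exact: (ctestM oOm tu.1 (ty _ tv)).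
  apply: (nullZ oOm cK KOm); apply: (null_divv oOm cK KOm sy).
  exact: (ctestM oOm tu.1 (tz _ tv)).
(* [null_sum] asks for null terms at every index, while the data are smooth only for [1 <= j <= N];
   the conditional supplies zero elsewhere. *)
pose D3 w : Rn -> R := fun x => \sum_(j <- index_iota 1 N.+1)
  (if (1 <= j <= N)%N then D1 w j else cst 0) x.
have nD3 w : ctest Om K w -> null_test Om K (D3 w).
  move=> tw; apply: (null_sum oOm cK KOm) => j; case: ifPn => [jN|_]; first exact: nD1.
  split; first exact: ctest0.
  by rewrite /integ /Rintegral integral0_eq.
exists (D3 u + D3 v + D2).
  apply: (nullD oOm cK KOm _ nD2).
  exact: (nullD oOm cK KOm (nD3 _ tu) (nD3 _ tv)).
move=> x Omx.
have S w : ctest Om K w ->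
    - (\sum_(1 <= j < N.+1) divv (a j) (f j * ivf (a j) w) x) * multiplier w x =
    2 * (\sum_(1 <= j < N.+1) ivf y (f j) x * ivf (a j) w x ^+ 2)
    + (\sum_(1 <= j < N.+1) second_order_coef j x) * w x ^+ 2 + D3 w x.
  move=> tw; rewrite -sumrN !mulr_suml mulr_sumr /D3 -!big_split /=.
  apply: eq_big_nat => j; rewrite ltnS => jN; rewrite jN.
  rewrite (second_order_identity jN tw.1 Omx) /D1 !fE.
  move: (ivf y (f j) x) (ivf (a j) w x) (second_order_coef j x) (w x)
    (divv (a j) (f j * ivf (a j) w * multiplier w) x)
    (divv y (f j * (ivf (a j) w * ivf (a j) w)) x)
    (divv (a j) (f j * ivf (a j) (dv y) * (w * w)) x) => *.
  ring.
have F := first_order_identity tu.1 tv.1 Omx.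
have dN : divv z (- u) x = - divv z u x.
  by rewrite /divv (ivfN oOm z tu.1 Omx) opprfctE mulrN opprD.
rewrite /adjoint_part dN.
have -> : (- u) x = - u x by [].
set Su := \sum_(1 <= j < N.+1) divv (a j) (f j * ivf (a j) u) x in S *.
set Sv := \sum_(1 <= j < N.+1) divv (a j) (f j * ivf (a j) v) x.
have {}Su' := S _ tu; have {}Sv' := S _ tv.
rewrite -/Su in Su'; rewrite -/Sv in Sv'.
transitivity (- Su * multiplier u x + - Sv * multiplier v x
  + (divv z v x * multiplier u x - divv z u x * multiplier v x)
  - divv y u x * multiplier u x - divv y v x * multiplier v x
  + (al x * u x + be x * v x) * multiplier u x
  + (al x * v x - be x * u x) * multiplier v x).
  clear Su' Sv'; move: (divv z v x) (divv z u x) (divv y u x) (divv y v x) (multiplier u x)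
    (multiplier v x) Su Sv (u x) (v x) (al x) (be x) => *.
  ring.
rewrite Su' Sv' F /D2 !fE.
have Mu w : multiplier w x = - (4 * ivf y w x + 2 * (dv y x * w x)) by [].
have Dy w : divv y w x = ivf y w x + dv y x * w x by [].
rewrite !Mu (Dy u) (Dy v).
move: (\sum_(1 <= j < N.+1) _) (\sum_(1 <= j < N.+1) _) (\sum_(1 <= j < N.+1) _).
move: (u x) (v x) (al x) (be x) (dv z x) (dv y x) (ivf y u x) (ivf y v x)
  (ivf z (dv y) x) (bracket v x) (D3 u x) (D3 v x)
  (divv z (u * ivf y v) x) (divv y (u * ivf z v) x) (divv z (dv y * (u * v)) x) => *.
ring.
Qed.

End energy_identity.

(** * Scalar inequalities behind the estimate *)

Section pointwise_estimates.
Context {R : realType}.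
Implicit Types (B C d p q u v : R).

Lemma sqr_le_norm d B : `|d| <= B -> d ^+ 2 <= B ^+ 2.
Proof. by move=> dB; rewrite -real_normK ?num_real// lerXn2r ?nnegrE ?(le_trans _ dB). Qed.

(** Each cross term is split by Young's inequality so that the total demand on [Yu^2] and on [Yv^2]
    stays below 3 of the 4 present, leaving at least one of each. In front of [u^2 + v^2], 120
    rounds up [36 + 64 + 16 + 3 + 1/8], and [4 C] comes from the bracket. *)
Lemma energy_absorb B C Ar Ai Mu Mv Eu Ev e u v Yu Yv d W dz Zd al be D :
  0 < C -> `|d| <= B -> `|dz| <= B -> `|Zd| <= B -> `|al| <= B -> `|be| <= B ->
  `|e| <= B -> 0 <= Eu -> 0 <= Ev -> W ^+ 2 <= C * (Ev + Yv ^+ 2) ->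
  Mu = - (4 * Yu + 2 * (d * u)) -> Mv = - (4 * Yv + 2 * (d * v)) ->
  Ar * Mu + Ai * Mv = 2 * Eu + 2 * Ev + e * (u ^+ 2 + v ^+ 2)
  + 4 * Yu ^+ 2 + 4 * Yv ^+ 2 + 6 * d * (u * Yu + v * Yv)
  + 2 * d ^+ 2 * (u ^+ 2 + v ^+ 2) + 4 * u * W - 4 * dz * v * Yu
  - 2 * (Zd + dz * d) * (u * v) - 4 * (al * u + be * v) * Yu
  - 4 * (al * v - be * u) * Yv - 2 * d * al * (u ^+ 2 + v ^+ 2) + D ->
  Yu ^+ 2 + Yv ^+ 2 + D <=
    16 * (Ar ^+ 2 + Ai ^+ 2) + (2 * B + 120 * B ^+ 2 + 4 * C) * (u ^+ 2 + v ^+ 2).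
Proof.
move=> C0 hd hdz hZ ha hb he Eu0 Ev0 hW MuE MvE S.
have B0 : 0 <= B by apply: le_trans hd.
have d2 := sqr_le_norm hd; have dz2 := sqr_le_norm hdz.
have a2 := sqr_le_norm ha; have b2 := sqr_le_norm hb.
have sq p q : 0 <= p -> p <= B ^+ 2 -> p * q ^+ 2 <= B ^+ 2 * q ^+ 2.
  by move=> p0 pB; rewrite ler_wpM2r ?sqr_ge0.
have bd p q : `|p| <= B -> p * q <= B * `|q|.
  move=> pB; apply: (le_trans (ler_norm _)); rewrite normrM.
  by rewrite ler_wpM2r.
(* The square of [4 A + (4 Y + 2 d w) / 8]: the weight 16 on [A^2] is what brings the cost down to
   half of a [Y^2]. *)
have A1 A M w Y : M = - (4 * Y + 2 * (d * w)) ->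
    A * M <= 16 * A ^+ 2 + Y ^+ 2 / 2 + B ^+ 2 * w ^+ 2 / 8.
  move=> ->; have := sqr_ge0 (4 * A + (4 * Y + 2 * (d * w)) / 8).
  have := sqr_ge0 (4 * Y - 2 * (d * w)).
  by have := sq _ w (sqr_ge0 d) d2; lra.
have p1 := A1 Ar Mu u Yu MuE; have p2 := A1 Ai Mv v Yv MvE.
have P3 w Y : - (6 * d * (w * Y)) <= Y ^+ 2 / 4 + 36 * (B ^+ 2 * w ^+ 2).
  have := sqr_ge0 (Y / 2 + 6 * (d * w)).
  by have := sq _ w (sqr_ge0 d) d2; lra.
have p3 := P3 u Yu; have p3' := P3 v Yv.
have p4 : 4 * dz * v * Yu <= Yu ^+ 2 / 4 + 16 * (B ^+ 2 * v ^+ 2).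
  have := sqr_ge0 (Yu / 2 - 4 * (dz * v)).
  by have := sq _ v (sqr_ge0 dz) dz2; lra.
have P5 w w' b Y : b ^+ 2 <= B ^+ 2 -> 4 * (al * w + b * w') * Y <=
    Y ^+ 2 / 4 + 32 * (B ^+ 2 * (w ^+ 2 + w' ^+ 2)).
  move=> hb2; have := sqr_ge0 (Y / 2 - 4 * (al * w + b * w')).
  have := sqr_ge0 (al * w - b * w').
  have := sq _ w (sqr_ge0 al) a2; have := sq _ w' (sqr_ge0 b) hb2; lra.
have p5 := P5 u v be Yu b2.
have p6 : 4 * (al * v - be * u) * Yv <= Yv ^+ 2 / 4 + 32 * (B ^+ 2 * (v ^+ 2 + u ^+ 2)).
  by have := P5 v u (- be) Yv; rewrite sqrrN mulNr; exact.
(* Multiplied by [C], this follows from the square of [W + 2 C u] and the bracket bound. The [Ev] is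
   paid by the [2 Ev] of the identity and the [Yv^2] by its [4 Yv^2]. *)
have p7 : - (4 * u * W) <= Ev + Yv ^+ 2 + 4 * C * u ^+ 2.
  have h : C * (- (4 * u * W)) <= C * (Ev + Yv ^+ 2 + 4 * C * u ^+ 2).
    by have := sqr_ge0 (W + 2 * (C * u)); lra.
  by rewrite ler_pM2l in h.
have uv : `|u * v| <= (u ^+ 2 + v ^+ 2) / 2.
  rewrite ler_norml; have := sqr_ge0 (u + v); have := sqr_ge0 (u - v).
  by move=> ? ?; apply/andP; split; lra.
have p8 : 2 * (Zd + dz * d) * (u * v) <= (B + B ^+ 2) * (u ^+ 2 + v ^+ 2).
  have h : `|Zd + dz * d| <= B + B ^+ 2.
    apply: (le_trans (ler_normD _ _)); rewrite normrM expr2.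
    by rewrite lerD// ler_pM.
  have : (Zd + dz * d) * (u * v) <= (B + B ^+ 2) * ((u ^+ 2 + v ^+ 2) / 2).
    apply: (le_trans (ler_norm _)); rewrite normrM.
    by apply: ler_pM.
  lra.
have H0 : 0 <= u ^+ 2 + v ^+ 2 by rewrite addr_ge0 ?sqr_ge0.
have p9 : 2 * d * al * (u ^+ 2 + v ^+ 2) <= 2 * B ^+ 2 * (u ^+ 2 + v ^+ 2).
  rewrite ler_wpM2r// -mulrA ler_wpM2l// expr2.
  by apply: (le_trans (ler_norm _)); rewrite normrM ler_pM.
have p10 : - (e * (u ^+ 2 + v ^+ 2)) <= B * (u ^+ 2 + v ^+ 2).
  rewrite -mulNr ler_wpM2r//; apply: le_trans he.
  by rewrite -normrN ler_norm.
have p11 : 0 <= 2 * d ^+ 2 * (u ^+ 2 + v ^+ 2).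
  by rewrite mulr_ge0// mulr_ge0// sqr_ge0.
have B2u : 0 <= B ^+ 2 * u ^+ 2 by rewrite mulr_ge0 ?sqr_ge0.
have B2v : 0 <= B ^+ 2 * v ^+ 2 by rewrite mulr_ge0 ?sqr_ge0.
have C20 : 0 <= C * v ^+ 2 by rewrite mulr_ge0 ?sqr_ge0// ltW.
have Y0 := sqr_ge0 Yu; have Y0' := sqr_ge0 Yv.
lra.
Qed.

(** The left side is what the expansion of [div (psi u^2 Y)] forces [(Y psi) u^2] to equal up to a
    divergence; every term keeps the factor [psi], hence the factor [eps]. *)
Lemma poincare_absorb B eps psi d u Yu :
  `|psi| <= eps -> `|d| <= B ->
  - (d * psi * u ^+ 2) - 2 * psi * u * Yu <= eps * ((B + 1) * u ^+ 2 + Yu ^+ 2).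
Proof.
move=> hp hd; have e0 : 0 <= eps by apply: le_trans hp.
have h1 : - (d * psi * u ^+ 2) <= eps * B * u ^+ 2.
  rewrite -mulNr ler_wpM2r ?sqr_ge0//; apply: (le_trans (ler_norm _)).
  by rewrite normrN normrM mulrC ler_pM.
have h2 : - (2 * psi * u * Yu) <= eps * (u ^+ 2 + Yu ^+ 2).
  apply: (le_trans (ler_norm _)); rewrite normrN.
  rewrite (_ : 2 * psi * u * Yu = psi * (2 * (u * Yu))); last by ring.
  rewrite normrM ler_pM// ler_norml.
  have := sqr_ge0 (u + Yu); have := sqr_ge0 (u - Yu).
  by move=> ? ?; apply/andP; split; lra.
lra.
Qed.

End pointwise_estimates.

Section a_priori.
Context {R : realType} {n : nat}.
Local Notation Rn := 'rV[R]_n.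
Variables (Om K : set Rn) (oOm : open Om) (cK : compact K) (KOm : K `<=` Om).
Variables (N : nat) (a : nat -> Rn -> Rn) (f : nat -> Rn -> R) (al be psi : Rn -> R).
Let y := a 0.
Let z := a N.+1.
Hypothesis sa : forall j, (j <= N.+1)%N -> smooth_vf Om (a j).
Hypothesis sf : forall j, (1 <= j <= N)%N -> smooth Om (f j).
Hypothesis sal : smooth Om al.
Hypothesis sbe : smooth Om be.
Hypothesis spsi : smooth Om psi.
Hypothesis comm : forall j, (1 <= j <= N)%N -> forall u, smooth Om u ->
  forall x, Om x -> ivf y (ivf (a j) u) x = ivf (a j) (ivf y u) x.
Hypothesis yf_ge0 : forall j, (1 <= j <= N)%N -> forall x, Om x -> 0 <= ivf y (f j) x.
Variables (B C eps c0 : R).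
Hypothesis C0 : 0 < C.
(** The factor adds the loss [2 B + 120 B^2 + 4 C] of [energy_absorb] to the loss [B + 1] of
    [poincare_absorb]; half of [c0] survives. *)
Hypothesis eps_small : eps * (3 * B + 120 * B ^+ 2 + 4 * C + 1) <= c0 / 2.
Hypothesis bound : forall x, K x -> [/\ `|dv y x| <= B, `|dv z x| <= B,
  `|ivf z (dv y) x| <= B, `|al x| <= B & `|be x| <= B] /\
  `|\sum_(1 <= j < N.+1) second_order_coef a f j x| <= B.
Hypothesis bracket_bound : forall x u, K x -> smooth Om u ->
  bracket N a u x ^+ 2 <=
  C * (\sum_(1 <= j < N.+1) ivf y (f j) x * ivf (a j) u x ^+ 2 + ivf y u x ^+ 2).
Hypothesis psi_small : forall x, K x -> `|psi x| <= eps.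
Hypothesis ypsi : forall x, K x -> c0 <= ivf y psi x.

Let sy : smooth_vf Om y. Proof. exact: sa. Qed.

(* The energy identity bounds |Y phi|^2 by |P^* phi|^2 + |phi|^2 up to a
   divergence; the Poincare inequality for Y comes from expanding
   div (psi |phi|^2 Y), and the smallness of psi absorbs |phi|^2. *)
Lemma adjoint_estimate u v : ctest Om K u -> ctest Om K v ->
  c0 / 2 * integ (u * u + v * v) <= 16 * eps *
  integ (adjoint_part N a f al be u v * adjoint_part N a f al be u v +
         adjoint_part N a f al be v (- u) * adjoint_part N a f al be v (- u)).
Proof.
move=> tu tv.
have [D nD DE] := energy_identity oOm cK KOm al be sa sf comm tu tv.
set A1 := adjoint_part N a f al be u v; set A2 := adjoint_part N a f al be v (- u).
have tA1 : ctest Om K A1 := ctest_adjoint_part oOm cK sa sf sal sbe tu tv.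
have tA2 : ctest Om K A2 :=
  ctest_adjoint_part oOm cK sa sf sal sbe tv (ctestN oOm tu).
have tH : ctest Om K (u * u + v * v).
  exact: (ctestD oOm (ctestM oOm tu.1 tu) (ctestM oOm tv.1 tv)).
have tA : ctest Om K (A1 * A1 + A2 * A2).
  exact: (ctestD oOm (ctestM oOm tA1.1 tA1) (ctestM oOm tA2.1 tA2)).
have tp w (tw : ctest Om K w) : ctest Om K (psi * (w * w)).
  exact: (ctestM oOm spsi (ctestM oOm tw.1 tw)).
(* The Poincare inequality costs [eps] times [|Y phi|^2], so the energy inequality enters multiplied
   by [eps], and its divergence with weight [- eps]. *)
pose D' := divv y (psi * (u * u)) + divv y (psi * (v * v)) + cst (- eps) * D.
have [tD' D'0] : null_test Om K D'.
  apply: (nullD oOm cK KOm _ (nullZ oOm cK KOm _ nD)).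
  apply: (nullD oOm cK KOm); apply: (null_divv oOm cK KOm sy).
    exact: tp tu.
  exact: tp tv.
rewrite -(integZ cK KOm _ tH) -(integZ cK KOm _ tA).
rewrite -[leRHS]addr0 -D'0.
have tcA : ctest Om K (cst (16 * eps) * (A1 * A1 + A2 * A2)).
  exact: (ctestM oOm (smooth_cst _) tA).
have tcH : ctest Om K (cst (c0 / 2) * (u * u + v * v)).
  exact: (ctestM oOm (smooth_cst _) tH).
rewrite -(integD cK KOm tcA tD').
apply: (integ_le cK KOm tcH (ctestD oOm tcA tD')) => x Kx.
have Omx := KOm Kx.
have [[b1 b2 b3 b4 b5] b6] := bound Kx.
have E0 w : 0 <= \sum_(1 <= j < N.+1) ivf y (f j) x * ivf (a j) w x ^+ 2.
  rewrite big_nat_cond sumr_ge0// => j; rewrite ltnS andbT => jN.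
  by rewrite mulr_ge0 ?sqr_ge0//; exact: yf_ge0.
have := energy_absorb C0 b1 b2 b3 b4 b5 b6 (E0 u) (E0 v) (bracket_bound Kx tv.1)
  erefl erefl (DE x Omx).
rewrite -/A1 -/A2 => est.
have pw w : smooth Om w -> divv y (psi * (w * w)) x =
    ivf y psi x * w x ^+ 2 + dv y x * psi x * w x ^+ 2 + 2 * psi x * w x * ivf y w x.
  move=> sw; rewrite /divv (ivfM y spsi (smoothM oOm sw sw) Omx) (ivfM y sw sw Omx).
  have -> : (psi * (w * w)) x = psi x * (w x * w x) by [].
  have -> : (w * w) x = w x * w x by [].
  move: (psi x) (w x) (ivf y w x) (ivf y psi x) (dv y x) => *.
  ring.
have pu := poincare_absorb (u x) (ivf y u x) (psi_small Kx) b1.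
have pv := poincare_absorb (v x) (ivf y v x) (psi_small Kx) b1.
have -> : (cst (c0 / 2) * (u * u + v * v)) x = c0 / 2 * (u x ^+ 2 + v x ^+ 2) by [].
have -> : (cst (16 * eps) * (A1 * A1 + A2 * A2) + D') x =
   16 * eps * (A1 x ^+ 2 + A2 x ^+ 2) +
   (divv y (psi * (u * u)) x + divv y (psi * (v * v)) x + - eps * D x) by [].
rewrite (pw _ tu.1) (pw _ tv.1).
have yp := ypsi Kx; have e0 : 0 <= eps by apply: le_trans (psi_small Kx).
move: est pu pv yp; move: (A1 x) (A2 x) (D x) (psi x) (u x) (v x) (ivf y u x)
  (ivf y v x) (ivf y psi x) (dv y x) => Ar Ai Dx p ux vx Yu Yv Yp d est pu pv yp.
have H0 : 0 <= ux ^+ 2 + vx ^+ 2 by rewrite addr_ge0 ?sqr_ge0.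
have h1 := ler_wpM2l e0 est.
have h2 := ler_wpM2r H0 eps_small.
have h3 := ler_wpM2r H0 yp.
lra.
Qed.

End a_priori.

(** * From operators and symbols to real vector fields *)

Section coordinates.
Context {R : realType} {n : nat}.
Local Notation Rn := 'rV[R]_n.
Implicit Types (Om K : set Rn) (b : Rn -> Rn) (phi : Rn -> R[i]).

Lemma is_derive_coord (l : 'I_n) (x v : Rn) :
  is_derive x v (fun p : Rn => p ord0 l) (v ord0 l).
Proof.
have E : \forall h \near (0 : R)^', cst (v ord0 l) h =
    h^-1 *: ((h *: v + x) ord0 l - x ord0 l).
  apply: filterS (nbhs_dnbhs_neq 0) => h h0.
  by rewrite !mxE addrK [RHS]mulrA mulVf// mul1r.
have L : (h^-1 *: ((h *: v + x) ord0 l - x ord0 l) @[h --> (0 : R)^']) --> v ord0 l.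
  exact: (cvg_trans (near_eq_cvg E) (cvg_cst _)).
apply: DeriveDef; first by apply/cvg_ex; exists (v ord0 l).
exact: cvg_lim L.
Qed.

Lemma partial_coord (k l : 'I_n) (x : Rn) :
  partial k (fun p : Rn => p ord0 l) x = (l == k)%:R.
Proof.
rewrite [LHS](@derive_val _ _ _ _ _ _ _ (is_derive_coord l x (delta_mx ord0 k))).
by rewrite mxE eqxx.
Qed.

Lemma smooth_coord Om (l : 'I_n) : smooth Om (fun p : Rn => p ord0 l).
Proof.
apply: (@smooth_coind _ _ Om (fun g => g = (fun p => p ord0 l) \/ exists c, g = cst c)).
- move=> _ [->|[c ->]] x _; split.
  + exact: coord_continuous.
  + by move=> k; have [] := is_derive_coord l x (delta_mx ord0 k).
  + exact: cst_continuous.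
  + by move=> k; exact: derivable_cst.
- move=> _ k [->|[c ->]]; right.
    by exists (l == k)%:R; apply/funext => x; exact: partial_coord.
  by exists 0; apply/funext => x; exact: partial_cst.
- by left.
Qed.

Lemma smooth_linear Om (c : 'I_n -> R) :
  open Om -> smooth Om (fun p : Rn => \sum_(l < n) c l * p ord0 l).
Proof.
move=> oOm; apply: (smooth_sum oOm) => l _.
exact: (smoothM oOm (smooth_cst (c l)) (smooth_coord l)).
Qed.

Lemma partial_linear (c : 'I_n -> R) k (x : Rn) :
  partial k (fun p : Rn => \sum_(l < n) c l * p ord0 l) x = c k.
Proof.
have s l : smooth setT (fun p : Rn => c l * p ord0 l).
  exact: (smoothM openT (smooth_cst (c l)) (smooth_coord l)).
rewrite (partial_sum openT _ k s I) (bigD1 k)//= [X in _ + X]big1.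
  rewrite [LHS]addr0 [LHS](partialM k (smooth_cst (c k)) (smooth_coord k) I).
  by rewrite partial_coord partial_cst eqxx mulr1 mulr0 addr0.
move=> l /negPf lk.
rewrite [LHS](partialM k (smooth_cst (c l)) (smooth_coord l) I).
by rewrite partial_coord partial_cst lk !mulr0 addr0.
Qed.

(** [X = - i Y] with [Y] real, so [X (u + i v) = Y v - i Y u]. *)
Lemma vf_opE b phi x : vf_op b phi x =
  (ivf b (fun p => complex.Im (phi p)) x +i* - ivf b (fun p => complex.Re (phi p)) x)%C.
Proof.
rewrite /vf_op /ivf -sumrN.
have csumE (F G : 'I_n -> R) :
    ((\sum_k F k) +i* (\sum_k G k))%C = \sum_k (F k +i* G k)%C.
  elim: (index_enum _) => [|k r IH]; first by rewrite !big_nil.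
  by rewrite !big_cons -IH.
rewrite csumE; apply: eq_bigr => k _; rewrite /Dop; by simpc.
Qed.

(** Testing the commutator on real functions suffices: there the composition of the two operators is
    minus the composition of the real fields. *)
Lemma ivf_comm Om b c : open Om -> smooth_vf Om b -> smooth_vf Om c ->
  (forall phi, csmooth Om phi -> forall x, Om x ->
     commutator (vf_op b) (vf_op c) phi x = 0) ->
  forall u, smooth Om u -> forall x, Om x -> ivf b (ivf c u) x = ivf c (ivf b u) x.
Proof.
move=> oOm sb sc H u su x Omx.
have := H (fun p => (u p)%:C%C) (conj su (smooth_cst 0)) x Omx.
rewrite /commutator (vf_opE b) (vf_opE c) => /(congr1 (@complex.Re R)) /=.
have E d : (fun p => complex.Im (vf_op d (fun p => (u p)%:C%C) p)) = - ivf d u.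
  by apply/funext => p; rewrite vf_opE.
rewrite !E (ivfN oOm b (smooth_ivf oOm sc su) Omx) (ivfN oOm c (smooth_ivf oOm sb su) Omx).
by move/eqP; rewrite opprK addrC subr_eq0 => /eqP.
Qed.

(** Symbols of vector fields are linear in [xi], so their Poisson bracket is the symbol of the
    bracket of the real fields, with the coefficients of [ivf_bracket]. *)
Lemma poissonE Om b c x xi : smooth_vf Om b -> smooth_vf Om c -> open Om -> Om x ->
  poisson (vf_symbol b) (vf_symbol c) x xi =
  \sum_(l < n) (ivf b (fun p => c p ord0 l) x - ivf c (fun p => b p ord0 l) x) *
     xi ord0 l.
Proof.
move=> sb sc oOm Omx.
have P d k : partial k (vf_symbol d x) xi = d x ord0 k.
  exact: (partial_linear (fun l => d x ord0 l)).
have Q d k : smooth_vf Om d -> partial k (vf_symbol d ^~ xi) x =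
    \sum_(l < n) partial k (fun p => d p ord0 l) x * xi ord0 l.
  move=> sd; have s l : smooth Om (fun p => d p ord0 l * xi ord0 l).
    exact: (smoothM oOm (sd l) (smooth_cst (xi ord0 l))).
  rewrite [LHS](partial_sum oOm _ k s Omx); apply: eq_bigr => l _.
  rewrite [LHS](partialM k (sd l) (smooth_cst (xi ord0 l)) Omx).
  by rewrite partial_cst mulr0 add0r mulrC.
rewrite /poisson.
transitivity (\sum_(k < n) \sum_(l < n) (b x ord0 k * partial k (fun p => c p ord0 l) x
   - c x ord0 k * partial k (fun p => b p ord0 l) x) * xi ord0 l).
  apply: eq_bigr => k _; rewrite !P (Q b k sb) (Q c k sc).
  rewrite mulr_sumr mulr_suml -sumrB; apply: eq_bigr => l _.
  ring.
rewrite exchange_big /=; apply: eq_bigr => l _.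
by rewrite -mulr_suml sumrB.
Qed.

Lemma smooth_bounded Om K (g : Rn -> R) : compact K -> K `<=` Om -> smooth Om g ->
  exists2 B, 0 <= B & forall x, K x -> `|g x| <= B.
Proof.
move=> cK KOm sg.
have cg : {within K, continuous g}.
  apply: continuous_in_subspaceT => x; rewrite inE => /KOm Omx.
  exact: smooth_continuous sg Omx.
have /compact_bounded[M [_ MP]] := continuous_compact cg cK.
exists (`|M| + 1) => [|x Kx]; first by rewrite addr_ge0.
apply: MP; last by exists x.
by rewrite (le_lt_trans (ler_norm _))// ltrDl.
Qed.

Lemma smooth_sum_nat Om N (F : nat -> Rn -> R) : open Om ->
  (forall j, (1 <= j <= N)%N -> smooth Om (F j)) ->
  smooth Om (fun x => \sum_(1 <= j < N.+1) F j x).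
Proof.
move=> oOm sF; rewrite (_ : (fun _ => _) = fun x =>
   \sum_(1 <= j < N.+1 | (1 <= j <= N)%N) F j x); first exact: (smooth_sum oOm).
apply/funext => x; rewrite big_nat_cond [RHS]big_nat_cond; apply: eq_bigl => j.
by rewrite ltnS andbT andbb.
Qed.

End coordinates.

(** * Choice of the neighbourhood *)

Section local_estimate.
Context {R : realType} {n : nat}.
Local Notation Rn := 'rV[R]_n.

(** The coefficient bounds and the constant of hypothesis (iii) are taken on a fixed neighbourhood
    and remain valid on every smaller ball; the final radius is chosen after them, so there is no
    circularity. *)
Lemma local_estimate (N : nat) (Om : set Rn) (a : nat -> Rn -> Rn)
  (f : nat -> Rn -> R) (a0 : Rn -> R[i]) :
  open Om ->
  (forall j, (j <= N.+1)%N -> smooth_vf Om (a j)) ->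
  (forall j, (1 <= j <= N)%N -> smooth Om (f j)) ->
  csmooth Om a0 ->
  (forall x, Om x -> a 0 x != 0) ->
  (forall j, (1 <= j <= N)%N -> forall x, Om x -> 0 <= ivf (a 0) (f j) x) ->
  (forall j, (1 <= j <= N)%N -> forall phi, csmooth Om phi -> forall x, Om x ->
     commutator (vf_op (a 0)) (vf_op (a j)) phi x = 0) ->
  (forall x0, Om x0 -> exists (U : set Rn) (C : R),
     [/\ open U, bounded_set U, U `<=` Om, U x0 & 0 < C /\
       forall x xi, U x ->
         `|poisson (vf_symbol (a 0)) (vf_symbol (a N.+1)) x xi| ^+ 2 <=
         C * (\sum_(1 <= j < N.+1)
                ivf (a 0) (f j) x * vf_symbol (a j) x xi ^+ 2
              + vf_symbol (a 0) x xi ^+ 2)]) ->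
  forall x0, Om x0 -> exists (K : set Rn) (c : R),
    [/\ compact K, K `<=` Om, interior K x0, 0 <= c &
     forall u v, ctest Om K u -> ctest Om K v ->
       integ (u * u + v * v) <= c * integ
         (adjoint_part N a f (fun x => complex.Re (a0 x)) (fun x => complex.Im (a0 x)) u v *
          adjoint_part N a f (fun x => complex.Re (a0 x)) (fun x => complex.Im (a0 x)) u v +
          adjoint_part N a f (fun x => complex.Re (a0 x)) (fun x => complex.Im (a0 x)) v (- u) *
          adjoint_part N a f (fun x => complex.Re (a0 x)) (fun x => complex.Im (a0 x)) v (- u))].
Proof.
move=> oOm sa sf [sal sbe] y0 yf comm pb x0 Omx0.
have [U [C [oU _ UOm Ux0 [C0 UC]]]] := pb x0 Omx0.
(* The linear function whose gradient is the vector [a 0 x0]: at [x0] its [Y] derivative is the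
   squared Euclidean length of that vector, positive by (i). Subtracting its value at [x0] makes
   [psi] of size [r] on the ball of radius [r]. *)
pose psi0 (x : Rn) : R := \sum_(l < n) a 0 x0 ord0 l * x ord0 l.
pose psi : Rn -> R := psi0 - cst (psi0 x0).
have sy : smooth_vf Om (a 0) by exact: sa.
have sz : smooth_vf Om (a N.+1) by exact: sa.
have s0 : smooth Om psi0 := smooth_linear (a 0 x0 ord0) oOm.
have spsi : smooth Om psi := smoothB oOm s0 (smooth_cst (psi0 x0)).
have ypsiE x : Om x -> ivf (a 0) psi x = \sum_(l < n) a 0 x ord0 l * a 0 x0 ord0 l.
  move=> Omx; rewrite (ivfB oOm (a 0) s0 (smooth_cst (psi0 x0)) Omx) ivf_cst subr0.
  by apply: eq_bigr => l _; rewrite /psi0 (partial_linear (a 0 x0 ord0)).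
pose c0 := ivf (a 0) psi x0 / 2.
have c00 : 0 < c0.
  rewrite divr_gt0// ypsiE// lt_neqAle; apply/andP; split; last first.
    by apply: sumr_ge0 => l _; rewrite -expr2 sqr_ge0.
  rewrite eq_sym psumr_eq0 => [|l _]; last by rewrite -expr2 sqr_ge0.
  apply: contra (y0 x0 Omx0) => /allP H; apply/eqP/rowP => l; rewrite mxE.
  by have := H l (mem_index_enum _); rewrite /= -expr2 sqrf_eq0 => /eqP.
have near1 : \forall x \near x0, c0 < ivf (a 0) psi x.
  have cy := smooth_continuous (smooth_ivf oOm sy spsi) Omx0.
  apply: (cy [set t | c0 < t]); apply: open_nbhs_nbhs; split; first exact: open_gt.
  by move: c00; rewrite /c0 /=; move: (ivf _ _ _) => t; lra.
have nearU : \forall x \near x0, U x by exact: open_nbhs_nbhs.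
have /nbhs_ballP[r1 /= r10 r1P] : \forall x \near x0, c0 < ivf (a 0) psi x /\ U x.
  by apply: filterI.
pose B0 (r : R) := [set x : Rn | `|x - x0| <= r].
have cB0 r : compact (B0 r).
  apply: bounded_closed_compact.
    exists (r + `|x0|); split; first exact: num_real.
    move=> M rM x /= xr; rewrite -[x](subrK x0).
    by rewrite (le_trans (ler_normD _ _))// (le_trans _ (ltW rM))// lerD2r.
  rewrite (_ : B0 r = (fun x : Rn => `|x - x0|) @^-1` [set t | t <= r]) //.
  apply: closed_comp; last exact: closed_le.
  move=> x _; apply: continuous_comp; last exact: norm_continuous.
  exact: (@continuousB _ _ _ id (cst x0) x (@cvg_id _ _) (@cst_continuous _ _ x0 x)).
have B0in r x : r < r1 -> B0 r x -> c0 < ivf (a 0) psi x /\ U x.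
  move=> rr1 xr; apply: r1P; rewrite -ball_normE /= distrC.
  exact: le_lt_trans rr1.
pose r2 := r1 / 2; have r21 : r2 < r1 by rewrite gtr_pMr ?invf_lt1 ?ltr1n.
have r20 : 0 < r2 by rewrite divr_gt0.
have B2Om : B0 r2 `<=` Om by move=> x /(B0in _ _ r21)[_ /UOm].
have sE : smooth Om (fun x => \sum_(1 <= j < N.+1) second_order_coef a f j x).
  apply: (smooth_sum_nat oOm) => j jN.
  have sb : smooth_vf Om (a j) by apply: sa; case/andP: jN => _ /leqW.
  apply: (divv_smooth oOm sb).
  exact: (smoothM oOm (sf j jN) (smooth_ivf oOm sb (smooth_dv oOm sy))).
have bd g := @smooth_bounded R n Om (B0 r2) g (cB0 r2) B2Om.
have [b1 b10 B1] := bd _ (smooth_dv oOm sy).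
have [b2 b20 B2] := bd _ (smooth_dv oOm sz).
have [b3 b30 B3] := bd _ (smooth_ivf oOm sz (smooth_dv oOm sy)).
have [b4 b40 B4] := bd _ sal.
have [b5 b50 B5] := bd _ sbe.
have [b6 b60 B6] := bd _ sE.
pose B := b1 + b2 + b3 + b4 + b5 + b6.
have B_ge0 : 0 <= B by rewrite !addr_ge0.
have [b1B b2B b3B] : [/\ b1 <= B, b2 <= B & b3 <= B].
  by rewrite /B; clear -b10 b20 b30 b40 b50 b60; split; lra.
have [b4B b5B b6B] : [/\ b4 <= B, b5 <= B & b6 <= B].
  by rewrite /B; clear -b10 b20 b30 b40 b50 b60; split; lra.
pose Q := 3 * B + 120 * B ^+ 2 + 4 * C + 1.
have Q0 : 0 < Q.
  by rewrite ltr_wpDl// !addr_ge0// ?mulr_ge0// ?sqr_ge0// ltW.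
(* Lipschitz constant of [psi] for the sup norm. *)
pose L := \sum_(l < n) `|a 0 x0 ord0 l|.
have L0 : 0 <= L by apply: sumr_ge0 => l _.
(* The second entry gives [L r Q <= r (L Q + 1) <= c0 / 2]; the added 1 makes the denominator
   positive without a lower bound on [L]. *)
pose r := Num.min r2 (c0 / (2 * (L * Q + 1))).
have LQ : 0 < L * Q + 1 by rewrite ltr_wpDl// mulr_ge0// ltW.
have r0 : 0 < r by rewrite lt_min r20 divr_gt0// mulr_gt0.
have rr2 : r <= r2 by rewrite ge_min lexx.
have B02 : B0 r `<=` B0 r2 by move=> x /= xr; exact: le_trans rr2.
have BOm : B0 r `<=` Om by move=> x /B02 /B2Om.
pose eps := L * r.
have eps_small : eps * Q <= c0 / 2.
  have rc : r <= c0 / (2 * (L * Q + 1)) by rewrite ge_min lexx orbT.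
  have LQ0 : 0 <= L * Q by rewrite mulr_ge0// ltW.
  apply: (@le_trans _ _ (r * (L * Q + 1))).
    by rewrite /eps mulrAC mulrC ler_wpM2l ?(ltW r0)// lerDl.
  apply: (le_trans (ler_wpM2r (ltW LQ) rc)).
  by rewrite invfM mulrA mulfVK// gt_eqF.
exists (B0 r), (16 * eps / (c0 / 2)); split => //.
- apply/nbhs_ballP; exists r => //= x; rewrite -ball_normE /= distrC.
  exact: ltW.
- apply: divr_ge0; last by apply: ltW; rewrite divr_gt0.
  by rewrite mulr_ge0// mulr_ge0// ltW.
- move=> u v tu tv.
  have div_le (p q I1 I2 : R) : 0 < p -> p * I1 <= q * I2 -> I1 <= q / p * I2.
    by move=> p0 h; rewrite mulrAC ler_pdivlMr// mulrC.
  apply: div_le; first by rewrite divr_gt0.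
  apply: (@adjoint_estimate R n Om (B0 r) oOm (cB0 r) BOm N a f _ _ psi sa sf sal sbe spsi
    _ yf B C eps c0 C0 eps_small) => //.
  + move=> j jN w sw x Omx; apply: (ivf_comm oOm sy _ (comm j jN) sw Omx).
    by apply: sa; case/andP: jN => _ /leqW.
  + move=> x /B02 Kx; have := (B1 x Kx, B2 x Kx, B3 x Kx, (B4 x Kx, B5 x Kx, B6 x Kx)).
    move=> [[[h1 h2] h3] [[h4 h5] h6]].
    by split; [split|]; [exact: le_trans h1 b1B|exact: le_trans h2 b2B|
      exact: le_trans h3 b3B|exact: le_trans h4 b4B|exact: le_trans h5 b5B|
      exact: le_trans h6 b6B].
  + move=> x w Kx sw; have [_ Ux] := B0in _ _ (le_lt_trans rr2 r21) Kx.
    (* Hypothesis (iii) is used at the covector [xi] equal to the gradient of [w] at [x], where each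
       symbol becomes the real field applied to [w]. *)
    have := UC x (\row_k partial k w x) Ux.
    have Omx := BOm x Kx.
    rewrite (poissonE _ sy sz oOm Omx) real_normK ?num_real//.
    have V b : vf_symbol b x (\row_k partial k w x) = ivf b w x.
      by apply: eq_bigr => k _; rewrite mxE.
    rewrite V; under [in X in _ <= X -> _]eq_bigr do rewrite V.
    rewrite /bracket.
    have -> : (ivf (a 0) (ivf (a N.+1) w) - ivf (a N.+1) (ivf (a 0) w)) x =
      ivf (a 0) (ivf (a N.+1) w) x - ivf (a N.+1) (ivf (a 0) w) x by [].
    rewrite (ivf_bracket oOm sy sz sw Omx).
    have -> : \sum_(l < n) (ivf (a 0) (fun p => a N.+1 p ord0 l) x -
        ivf (a N.+1) (fun p => a 0 p ord0 l) x) * (\row_k partial k w x) ord0 l =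
      \sum_(l < n) (ivf (a 0) (fun p => a N.+1 p ord0 l) x -
        ivf (a N.+1) (fun p => a 0 p ord0 l) x) * partial l w x => //.
    by apply: eq_bigr => l _; rewrite mxE.
  + move=> x Kx; rewrite /psi /psi0 -[(_ - _) x]/(_ - _) -sumrB /eps /L mulr_suml.
    apply: (le_trans (ler_norm_sum _ _ _)); apply: ler_sum => l _.
    rewrite -mulrBr normrM ler_wpM2l//; apply: le_trans Kx.
    by have := ler_rV_norm (x - x0) l; rewrite !mxE.
  + by move=> x Kx; have [/ltW] := B0in _ _ (le_lt_trans rr2 r21) Kx.
Qed.

End local_estimate.

(** * Hilbert space argument *)

Section L2_pairing.
Context {R : realType} d (T : measurableType d) (mu : {measure set T -> \bar R}).
Variables (D : set T) (mD : measurable D).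
Implicit Types (p q w : T -> R).

Definition L2on w := measurable_fun D w /\
  mu.-integrable D (EFin \o (fun x => w x ^+ 2)).

Definition L2_pair w p : R := Rintegral mu D (fun x => w x * p x).

Lemma L2onP w : measurable_fun D w ->
  (\int[mu]_(x in D) (w x ^+ 2)%:E < +oo)%E -> L2on w.
Proof.
move=> mw fw; split=> //; apply/integrableP; split.
  by apply/measurable_EFinP; exact: measurable_funX.
by under eq_integral do rewrite /= ger0_norm ?sqr_ge0//.
Qed.

Lemma L2on_mul_integrable w p : L2on w -> L2on p ->
  mu.-integrable D (EFin \o (fun x => w x * p x)).
Proof.
move=> [mw iw] [mp ip]; apply: (le_integrable mD _ _ (integrableD mD iw ip)).
  by apply/measurable_EFinP; exact: measurable_funM.
move=> x _ /=; rewrite lee_fin [leRHS]ger0_norm ?addr_ge0 ?sqr_ge0//.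
rewrite ler_norml; have := sqr_ge0 (w x - p x); have := sqr_ge0 (w x + p x).
have := sqr_ge0 (w x); have := sqr_ge0 (p x).
by move=> *; apply/andP; split; lra.
Qed.

Lemma L2onD w p : L2on w -> L2on p -> L2on (fun x => w x + p x).
Proof.
move=> Lw Lp; have [[mw iw] [mp ip]] := (Lw, Lp).
have iwp := L2on_mul_integrable Lw Lp.
split; first exact: measurable_funD.
rewrite (_ : _ \o _ = ((EFin \o (fun x => (w x ^+ 2)%R)) \+ (EFin \o (fun x => (p x ^+ 2)%R)))
    \+ (fun x => 2%:E * (EFin \o (fun x => (w x * p x)%R)) x))%E; last first.
  by apply/funext => x /=; congr EFin; ring.
by apply: integrableD => //; [exact: integrableD|exact: integrableZl].
Qed.

Lemma L2onZ c w : L2on w -> L2on (fun x => c * w x).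
Proof.
move=> [mw iw]; split; first exact: measurable_funM.
rewrite (_ : _ \o _ = (fun x => (c ^+ 2)%R%:E * (EFin \o (fun x => (w x ^+ 2)%R)) x))%E.
  exact: integrableZl.
by apply/funext => x /=; rewrite exprMn.
Qed.

Lemma pairC w p : L2_pair w p = L2_pair p w.
Proof. by apply: eq_Rintegral => x _; rewrite mulrC. Qed.

Lemma pairDZ t w p q : L2on w -> L2on p -> L2on q ->
  L2_pair w (fun x => p x + t * q x) = L2_pair w p + t * L2_pair w q.
Proof.
move=> Lw Lp Lq; have iwp := L2on_mul_integrable Lw Lp.
have iwq := L2on_mul_integrable Lw Lq.
rewrite /L2_pair -(RintegralZl t mD iwq) -(RintegralD mD iwp); last first.
  exact: (integrableZl mD t iwq).
by apply: eq_Rintegral => x _; ring.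
Qed.

Lemma pair_ge0 w : 0 <= L2_pair w w.
Proof. by apply: Rintegral_ge0 => x _; rewrite -expr2 sqr_ge0. Qed.

Lemma pair_sqr_fin w : L2on w ->
  (\int[mu]_(x in D) (w x ^+ 2)%:E = (L2_pair w w)%:E)%E.
Proof.
move=> [mw iw]; rewrite /L2_pair /Rintegral fineK//.
exact: (integrable_fin_num mD iw).
Qed.

(** A weighted Cauchy-Schwarz inequality free of square roots: when the norm of [w] is of order [e],
    both terms on the right are of order [e]. *)
Lemma pair_bound e w p : 0 < e -> L2on w -> L2on p ->
  `|L2_pair w p| <= e^-1 * L2_pair w w + e * L2_pair p p.
Proof.
move=> e0 Lw Lp; have iwp := L2on_mul_integrable Lw Lp.
have ww := L2on_mul_integrable Lw Lw; have pp := L2on_mul_integrable Lp Lp.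
apply: (le_trans (le_normr_Rintegral mD iwp)).
have zw := integrableZl mD (e^-1) ww; have zp := integrableZl mD e pp.
rewrite /L2_pair -(RintegralZl (e^-1) mD ww) -(RintegralZl e mD pp) -RintegralD//.
apply: le_Rintegral => //.
- exact: (integrable_norm iwp).
- exact: (integrableD mD zw zp).
move=> x _ /=; rewrite -(ler_pM2l e0) mulrDr !mulrA mulfV ?gt_eqF// mul1r.
rewrite -[X in X * `|_|]ger0_norm ?(ltW e0)// -normrM ler_norml.
have := sqr_ge0 (w x - e * p x); have := sqr_ge0 (w x + e * p x).
have := sqr_ge0 (w x); have := sqr_ge0 (e * p x).
by move=> *; apply/andP; split; lra.
Qed.

End L2_pairing.

(** * Minimization of a quadratic functional *)

Section minimizing_sequence.
Context {R : realType} {V : lmodType R}.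

Lemma discriminant_le (p q e : R) : 0 <= p -> 0 <= e ->
  (forall t, 0 <= p * t ^+ 2 + 2 * q * t + e) -> q ^+ 2 <= e * p.
Proof.
move=> p0 e0 H; have [p00|pn0] := eqVneq p 0.
  suff -> : q = 0 by rewrite expr0n /= mulr_ge0.
  (* At this [t] the degenerate polynomial [2 q t + e] takes the value [-1]. *)
  apply/eqP/negPn/negP => q0; have := H (- (e + 1) / (2 * q)).
  rewrite p00 mul0r add0r mulrC divfK ?mulf_neq0 ?pnatr_eq0//; lra.
have pp : 0 < p by rewrite lt_neqAle eq_sym pn0.
have := H (- q / p); rewrite (_ : _ + e = e - q ^+ 2 / p); last by field.
by rewrite subr_ge0 ler_pdivrMr.
Qed.

(** The form [b] is only semidefinite and the space is not completed, so the outcome is a Cauchy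
    sequence for [b] satisfying the Euler equation [b x w = l w] up to an error controlled by
    [eps n]. *)
Lemma minimizing_sequence (S : set V) (b : V -> V -> R) (l : V -> R) (C : R)
  (eps : nat -> R) :
  S 0 -> (forall t x w, S x -> S w -> S (x + t *: w)) ->
  (forall x w, S x -> S w -> b x w = b w x) ->
  (forall t x w v, S x -> S w -> S v -> b (x + t *: w) v = b x v + t * b w v) ->
  (forall x, S x -> 0 <= b x x) ->
  (forall t x w, S x -> S w -> l (x + t *: w) = l x + t * l w) ->
  (forall x, S x -> 2 * l x <= C + b x x) ->
  (forall n, 0 < eps n) ->
  exists x : nat -> V, [/\ forall n, S (x n),
    forall n m, b (x n - x m) (x n - x m) <= 2 * (eps n + eps m) &
    forall n w, S w -> (b (x n) w - l w) ^+ 2 <= eps n * b w w].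
Proof.
move=> S0 SD bC bD b0 lD lb eps0.
pose J x := b x x - 2 * l x.
(* The parallelogram identity makes a minimizing sequence of J Cauchy. *)
have hJ : has_inf (J @` S).
  split; first by exists (J 0), 0.
  by exists (- C) => _ [x Sx <-]; rewrite /J; have := lb x Sx; lra.
pose m := inf (J @` S).
have mJ x : S x -> m <= J x by move=> Sx; apply: ge_inf; [case: hJ|exists x].
have /choice[x xP] : forall n, exists x, S x /\ J x < m + eps n.
  by move=> n; have [_ [x Sx <-] Jx] := inf_adherent (eps0 n) hJ; exists x.
have JE t x' w : S x' -> S w ->
    J (x' + t *: w) = J x' + 2 * (b x' w - l w) * t + t ^+ 2 * b w w.
  move=> Sx Sw; have Sxw := SD t _ _ Sx Sw.
  rewrite /J bD// lD// (bC x')// (bC w)// !bD// (bC w x')//; ring.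
exists x; split=> [n|n k|n w Sw]; first by case: (xP n).
  have [[Sn Jn] [Sk Jk]] := (xP n, xP k).
  have Sd : S (x n - x k) by rewrite -scaleN1r; exact: SD.
  have SM : S (x n + (- 2^-1) *: (x n - x k)) by exact: SD.
  have E : x n + (-1) *: (x n - x k) = x k.
    by rewrite scaleN1r opprB addrC subrK.
  have J1 := JE (-1) _ _ Sn Sd; have J2 := JE (- 2^-1) _ _ Sn Sd.
  have J3 := mJ _ SM; rewrite E in J1.
  move: J1 J2 J3 Jn Jk.
  move: (b (x n - x k) (x n - x k)) (b (x n) (x n - x k) - l (x n - x k))%R => p q.
  move: (J (x n + _)) (J (x n)) (J (x k)) => jm jn jk.
  lra.
have [Sn Jn] := xP n.
(* [J (x n + t w) >= m > J (x n) - eps n] says that a quadratic polynomial in [t] is nonnegative;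
   its discriminant condition is the approximate Euler equation. *)
apply: discriminant_le => [||t]; [exact: b0|exact: ltW|].
have := mJ _ (SD t _ _ Sn Sw); rewrite JE//; move: Jn.
by move: (J _) (b _ _) (b _ _) (l _) => *; lra.
Qed.

End minimizing_sequence.

(** * Limits in L^2 *)

Section L2_limit.
Local Open Scope ereal_scope.
Context {R : realType} d (T : measurableType d) (mu : {measure set T -> \bar R}).

Lemma limn_einf_le (u : (\bar R)^nat) c : (forall n, u n <= c) -> limn_einf u <= c.
Proof.
move=> uc; rewrite limn_einf_lim; apply: lime_le; first exact: is_cvg_einfs.
apply: nearW => n; apply: le_trans (uc n); apply: ereal_inf_lbound => /=.
by exists n => //=.
Qed.

(* The increments are summable in L^1(D), so that h n converges almost
   everywhere, and Fatou's lemma bounds the distance to the limit. *)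
Lemma L2_fast_limit (D : set T) (h : nat -> T -> R) :
  measurable D -> mu D < +oo -> (forall n, measurable_fun D (h n)) ->
  (forall n m, (n <= m)%N ->
     \int[mu]_(x in D) ((h n x - h m x) ^+ 2)%:E <= ((2 ^ n.+1)%:R ^- 2)%:E) ->
  exists2 g : T -> R, measurable_fun D g &
    forall n, \int[mu]_(x in D) ((h n x - g x) ^+ 2)%:E <= ((2 ^ n.+1)%:R ^- 2)%:E.
Proof.
move=> mD Dfin mh hC.
pose del n x : R := `|h n.+1 x - h n x|%R.
have mdel n : measurable_fun D (del n).
  by apply: measurableT_comp => //; exact: measurable_funB.
pose F x := \sum_(0 <= n <oo) (del n x)%:E.
have del0 n x : 0 <= (del n x)%:E by rewrite lee_fin normr_ge0.
have mdelE n : measurable_fun D (fun x => (del n x)%:E) by exact/measurable_EFinP.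
have mF : measurable_fun D F.
  exact: ge0_emeasurable_sum.
have F0 x : 0 <= F x by apply: nneseries_ge0.
have muD : mu D \is a fin_num by rewrite ge0_fin_numE.
(* From [|t| <= 1 / e + e t^2] with [e = 2^(n+1)]: the first term integrates to [mu D / e], the
   second to at most [e / e^2]. Finiteness of [mu D] enters here. *)
have idel n : \int[mu]_(x in D) (del n x)%:E <=
    ((fine (mu D) + 1) / (2 ^ (n + 1))%:R)%:E.
  rewrite addn1; set e : R := (2 ^ n.+1)%:R.
  have e0 : (0 < e)%R by rewrite ltr0n expn_gt0.
  have mq : measurable_fun D (fun x => ((h n x - h n.+1 x) ^+ 2)%R).
    by apply: measurable_funX; exact: measurable_funB.
  apply: (@le_trans _ _ (\int[mu]_(x in D)
     ((e^-1)%:E + e%:E * ((h n x - h n.+1 x) ^+ 2)%:E))).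
    apply: ge0_le_integral => //.
    - apply: emeasurable_funD => //; apply: measurable_funeM.
      exact/measurable_EFinP.
    - move=> x _; rewrite -EFinM -EFinD lee_fin /del distrC.
      set t := (h n x - h n.+1 x)%R.
      rewrite -(ler_pM2l e0) mulrDr mulfV ?gt_eqF//.
      have := sqr_ge0 (e * `|t|)%R; have := sqr_ge0 (e * `|t| - 1)%R.
      rewrite -(real_normK (num_real t)); lra.
  rewrite ge0_integralD//; last 3 first.
  - by move=> x _; rewrite lee_fin invr_ge0 ltW.
  - by move=> x _; rewrite -EFinM lee_fin mulr_ge0 ?sqr_ge0// ltW.
  - by apply: measurable_funeM; exact/measurable_EFinP.
  have q0 x : D x -> 0 <= ((h n x - h n.+1 x) ^+ 2)%:E by rewrite lee_fin sqr_ge0.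
  have mqE : measurable_fun D (fun x => ((h n x - h n.+1 x) ^+ 2)%:E).
    exact/measurable_EFinP.
  rewrite integral_cst// (ge0_integralZl_EFin mu mD q0 mqE (ltW e0)).
  rewrite mulrDl EFinD mul1r -{1}(fineK muD) -EFinM mulrC leeD2l//.
  apply: (le_trans (lee_wpmul2l _ (hC _ _ (leqnSn n)))).
    by rewrite lee_fin ltW.
  by rewrite -EFinM lee_fin -/e expr2 invfM mulrA mulfV ?mul1r// gt_eqF.
have iF : mu.-integrable D F.
  apply/integrableP; split => //.
  under eq_integral do rewrite gee0_abs//.
  rewrite integral_nneseries//.
  apply: (@le_lt_trans _ _ (\sum_(0 <= n <oo)
      ((fine (mu D) + 1) / (2 ^ (n + 1))%:R)%:E)).
    by apply: lee_nneseries => [i _ _|i _]; [exact: integral_ge0|exact: idel].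
  have := @cvg_geometric_eseries_half R (fine (mu D) + 1)%R 0.
  by move=> /cvg_lim -> //; rewrite ltry.
have aeF := integrable_ae mD iF.
(* The upper limit is measurable on all of [D] and equals the limit of [h n x] wherever [F x] is
   finite; the other points form a null set. *)
pose g x := fine (limn_esup (fun n => (h n x)%:E)).
have mg : measurable_fun D g.
  apply: measurableT_comp => //; apply: measurable_fun_limn_esup => n.
  exact/measurable_EFinP.
have cvh x : D x -> F x \is a fin_num -> (h n x @[n --> \oo] --> g x)%classic.
  move=> Dx Fx.
  have cs : cvgn (series (fun n => h n.+1 x - h n x)%R).
    apply: normed_cvg; suff: cvgn (series (fun n => del n x)) by [].
    apply: nondecreasing_is_cvgn => [n m nm|].
      by apply: (nondecreasing_series (P := xpredT) (fun n _ _ => normr_ge0 _)) nm.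
    exists (fine (F x)) => _ [n _ <-]; rewrite -lee_fin fineK//.
    by rewrite /series /= -sumEFin; exact: nneseries_lim_ge.
  have ch : cvgn (h ^~ x).
    have -> : h ^~ x = (fun n => series (fun n => h n.+1 x - h n x)%R n + h 0%N x)%R.
      apply/funext => n; rewrite /series /= telescope_sumr//; ring.
    by apply: is_cvgD => //; exact: is_cvg_cst.
  suff -> : g x = limn (h ^~ x) by [].
  have cE : ((h n x)%:E @[n --> \oo] --> (limn (h ^~ x))%:E)%classic.
    by apply: cvg_EFin => //; exact: nearW.
  rewrite /g is_cvg_limn_esupE; last by apply/cvg_ex; eexists; exact: cE.
  by rewrite (cvg_lim _ cE).
exists g => // n.
have mq m : measurable_fun D (fun x => ((h n x - h (n + m)%N x) ^+ 2)%:E).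
  by apply/measurable_EFinP; apply: measurable_funX; exact: measurable_funB.
(* Almost everywhere the integrand is the lower limit of [(h n x - h (n + m) x)^2], and Fatou's
   lemma carries the uniform bound over to [g]. The shift [n + m] keeps the second index at least
   [n]. *)
have -> : \int[mu]_(x in D) ((h n x - g x) ^+ 2)%:E =
    \int[mu]_(x in D) limn_einf (fun m => ((h n x - h (n + m)%N x) ^+ 2)%:E).
  apply: ae_eq_integral => //.
  - by apply/measurable_EFinP; apply: measurable_funX; exact: measurable_funB.
  - rewrite (_ : (fun x => limn_einf _) = (fun x => - limn_esup (fun m =>
        - ((h n x - h (n + m)%N x) ^+ 2)%:E))); last first.
      apply/funext => x; rewrite -limn_einfN; congr limn_einf.
      by apply/funext => m; rewrite /comp oppeK.
    apply: measurableT_comp => //; apply: measurable_fun_limn_esup => m.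
    exact: measurableT_comp.
  - apply: filterS aeF => x FD Dx.
    have cx := cvh x Dx (FD Dx).
    have cq : (((h n x - h (n + m)%N x) ^+ 2)%:E @[m --> \oo] --> ((h n x - g x) ^+ 2)%:E)%classic.
      apply: cvg_EFin; first exact: nearW.
      have cs : (h (n + m)%N x @[m --> \oo] --> g x)%classic.
        move=> A /cx[k _ kA]; exists k => // m /= km; apply: kA => /=.
        exact: leq_trans km (leq_addl _ _).
      rewrite expr2; under eq_fun do rewrite expr2.
      by apply: cvgM; apply: cvgB => //; exact: cvg_cst.
    by rewrite is_cvg_limn_einfE; [exact/esym/cvg_lim|apply/cvg_ex; eexists; exact: cq].
apply: le_trans.
  by apply: fatou => // m x _; rewrite lee_fin sqr_ge0.
by apply: limn_einf_le => m; apply: hC; exact: leq_addr.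
Qed.

End L2_limit.

Section weak_solution.
Context {R : realType} d (T : measurableType d) (mu : {measure set T -> \bar R}).
Variables (D : set T) (mD : measurable D) (Dfin : (mu D < +oo)%E).
Variables (V : lmodType R) (S : set V) (A1 A2 : V -> T -> R) (l : V -> R) (C : R).
Hypotheses (S0 : S 0) (SD : forall t x w, S x -> S w -> S (x + t *: w)).
Hypothesis (L1 : forall x, S x -> L2on mu D (A1 x)).
Hypothesis (L2 : forall x, S x -> L2on mu D (A2 x)).
Hypothesis A1D : forall t x w p, S x -> S w -> D p ->
  A1 (x + t *: w) p = A1 x p + t * A1 w p.
Hypothesis A2D : forall t x w p, S x -> S w -> D p ->
  A2 (x + t *: w) p = A2 x p + t * A2 w p.
Hypothesis lD : forall t x w, S x -> S w -> l (x + t *: w) = l x + t * l w.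
Local Notation "<< f , g >>" := (L2_pair mu D f g).
Hypothesis lb : forall x, S x -> 2 * l x <= C + (<<A1 x, A1 x>> + <<A2 x, A2 x>>).

Let eq_pairr (p q w : T -> R) : (forall x, D x -> p x = q x) -> <<w, p>> = <<w, q>>.
Proof. by move=> pq; apply: eq_Rintegral => x; rewrite inE => /pq ->. Qed.

Lemma small_pow2 (r : R) : 0 < r -> exists n, (2 ^ n.+1)%:R^-1 < r.
Proof.
move=> r0; have [k] := ltr_add_invr r0; rewrite add0r => kr; exists k.
apply: le_lt_trans kr; rewrite lef_pV2 ?posrE ?ltr0n ?expn_gt0// ler_nat.
exact: ltnW (ltn_expl _ _).
Qed.

(** Closeness for [b] is closeness of the images under [A1] and [A2] in L^2, so these images of a
    minimizing sequence converge; their limits inherit the Euler equation. *)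
Lemma weak_solution_exists : exists w1 w2, [/\ L2on mu D w1, L2on mu D w2 &
  forall x, S x -> <<w1, A1 x>> + <<w2, A2 x>> = l x].
Proof.
pose b x w := <<A1 x, A1 w>> + <<A2 x, A2 w>>.
pose e n : R := (2 ^ n.+1)%:R^-1.
have e0 n : 0 < e n by rewrite invr_gt0 ltr0n expn_gt0.
have eN n m : (n <= m)%N -> e m <= e n.
  by move=> nm; rewrite lef_pV2 ?posrE ?ltr0n ?expn_gt0// ler_nat leq_exp2l.
(* The precision [e n ^+ 2 / 4] turns the Cauchy bound into [e n ^+ 2] for [m >= n], the rate that
   [L2_fast_limit] requires. *)
have [x [Sx xx xl]] : exists x : nat -> V, [/\ forall n, S (x n),
    forall n m, b (x n - x m) (x n - x m) <= 2 * (e n ^+ 2 / 4 + e m ^+ 2 / 4) &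
    forall n w, S w -> (b (x n) w - l w) ^+ 2 <= e n ^+ 2 / 4 * b w w].
  apply: (@minimizing_sequence R V S b l C) => //.
  - by move=> x w _ _; rewrite /b pairC [X in _ + X]pairC.
  - move=> t x w v Sx Sw Sv; rewrite /b.
    rewrite (pairC _ _ (A1 (x + _))) (pairC _ _ (A2 (x + _))).
    rewrite (@eq_pairr (A1 (x + t *: w)) (fun p => A1 x p + t * A1 w p)); last first.
      by move=> p Dp; exact: A1D.
    rewrite (@eq_pairr (A2 (x + t *: w)) (fun p => A2 x p + t * A2 w p)); last first.
      by move=> p Dp; exact: A2D.
    rewrite (pairDZ mD t (L1 Sv) (L1 Sx) (L1 Sw)) (pairDZ mD t (L2 Sv) (L2 Sx) (L2 Sw)).
    by rewrite !(pairC _ _ (A1 v)) !(pairC _ _ (A2 v)); ring.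
  - by move=> x _; rewrite addr_ge0// pair_ge0.
  - by move=> n; rewrite divr_gt0// exprn_gt0.
have dS n m : S (x n - x m) by rewrite -scaleN1r; exact: SD.
have bd n m : (n <= m)%N -> b (x n - x m) (x n - x m) <= e n ^+ 2.
  move=> nm; apply: (le_trans (xx n m)).
  have : e m ^+ 2 <= e n ^+ 2 by rewrite lerXn2r ?nnegrE ?(ltW (e0 _))// eN.
  by lra.
have lim A : (forall x, S x -> L2on mu D (A x)) ->
    (forall t x w p, S x -> S w -> D p -> A (x + t *: w) p = A x p + t * A w p) ->
    (forall x, S x -> <<A x, A x>> <= b x x) ->
    exists w, L2on mu D w /\ forall n,
      L2on mu D (fun p => A (x n) p + (-1) * w p) /\
      << (fun p => A (x n) p + (-1) * w p), (fun p => A (x n) p + (-1) * w p) >> <= e n ^+ 2.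
  move=> LA AD Ab.
  have [w mw hw] : exists2 w : T -> R, measurable_fun D w & forall n,
      (\int[mu]_(p in D) ((A (x n) p - w p) ^+ 2)%:E <= ((2 ^ n.+1)%:R ^- 2)%:E)%E.
    apply: L2_fast_limit => // [n|n m nm]; first by have [] := LA _ (Sx n).
    rewrite (_ : ((2 ^ n.+1)%:R ^- 2)%R = e n ^+ 2); last by rewrite exprVn.
    have -> : (\int[mu]_(p in D) ((A (x n) p - A (x m) p) ^+ 2)%:E =
        \int[mu]_(p in D) ((A (x n - x m) p) ^+ 2)%:E)%E.
      apply: eq_integral => p; rewrite inE => Dp.
      by rewrite -[x n - x m]/(x n + _) -scaleN1r (AD _ _ _ _ (Sx n) (Sx m) Dp) mulN1r.
    rewrite (pair_sqr_fin mD (LA _ (dS n m))) lee_fin.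
    exact: le_trans (Ab _ (dS n m)) (bd n m nm).
  have LB n : L2on mu D (fun p => A (x n) p + (-1) * w p).
    apply: L2onP => //.
      by apply: measurable_funD; [case: (LA _ (Sx n))|exact: measurable_funM].
    apply: le_lt_trans (ltry ((2 ^ n.+1)%:R ^- 2)); apply: le_trans (hw n).
    by under eq_integral do rewrite mulN1r.
  exists w; split=> [|n].
    have := L2onD mD (LA _ (Sx 0%N)) (L2onZ mD (-1) (LB 0%N)).
    rewrite (_ : (fun p => _) = w)//; apply/funext => p; ring.
  split; first exact: LB.
  rewrite -lee_fin -(pair_sqr_fin mD (LB n)) /e exprVn.
  by apply: le_trans (hw n); under eq_integral do rewrite mulN1r.
have [w1 [Lw1 h1]] := lim A1 L1 A1D (fun x _ => ler_wpDr (pair_ge0 _ _ _) (lexx _)).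
have [w2 [Lw2 h2]] := lim A2 L2 A2D (fun x _ => ler_wpDl (pair_ge0 _ _ _) (lexx _)).
exists w1, w2; split=> // q Sq; apply/eqP; rewrite -subr_eq0 -normr_le0 leNgt.
apply/negP => gap.
have bq0 : 0 <= b q q by rewrite addr_ge0// pair_ge0.
(* Error budget in units of [e n]: [2 + b q q] for replacing [w1], [w2] by the images of [x n], and
   [1 + b q q] for the approximate equation. *)
pose M := 3 + 2 * b q q.
have M0 : 0 < M by rewrite /M; lra.
have [n] := small_pow2 (divr_gt0 gap M0); rewrite -/(e n) ltr_pdivlMr// ltNge.
move=> /negP; apply.
have [[LB1 B1] [LB2 B2]] := (h1 n, h2 n).
have en0 := e0 n.
have E1 : << w1, A1 q >> = << A1 (x n), A1 q >> -
    << (fun p => A1 (x n) p + (-1) * w1 p), A1 q >>.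
  rewrite [X in _ - X]pairC (pairDZ mD (-1) (L1 Sq) (L1 (Sx n)) Lw1).
  by rewrite !(pairC _ _ (A1 q)); ring.
have E2 : << w2, A2 q >> = << A2 (x n), A2 q >> -
    << (fun p => A2 (x n) p + (-1) * w2 p), A2 q >>.
  rewrite [X in _ - X]pairC (pairDZ mD (-1) (L2 Sq) (L2 (Sx n)) Lw2).
  by rewrite !(pairC _ _ (A2 q)); ring.
have P1 := pair_bound mD en0 LB1 (L1 Sq).
have P2 := pair_bound mD en0 LB2 (L2 Sq).
have bl : `|b (x n) q - l q| <= e n * (1 + b q q).
  have nn : 0 <= e n * (1 + b q q) by rewrite mulr_ge0 ?(ltW en0)// addr_ge0.
  rewrite -ler_sqr ?nnegrE//.
  rewrite real_normK ?num_real// exprMn; apply: (le_trans (xl n q Sq)).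
  rewrite -mulrA ler_wpM2l ?sqr_ge0//.
  by move: bq0 (sqr_ge0 (b q q)); move: (b q q) => t *; lra.
have en (t : R) : t <= e n ^+ 2 -> (e n)^-1 * t <= e n.
  by move=> h; rewrite mulrC ler_pdivrMr// -expr2.
move: (en _ B1) (en _ B2) P1 P2 bl; rewrite E1 E2 /M /b.
move: (L2_pair _ _ (A1 (x n)) _) (L2_pair _ _ (A2 (x n)) _) (L2_pair _ _ (A1 q) (A1 q))
  (L2_pair _ _ (A2 q) (A2 q)) (L2_pair _ _ _ (A1 q)) (L2_pair _ _ _ (A2 q)) => p1 p2 q1 q2 r1 r2.
move=> g1 g2 P1 P2 bl.
have -> : p1 - r1 + (p2 - r2) - l q = (p1 + p2 - l q) - r1 - r2 by ring.
apply: (le_trans (ler_normB _ _)).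
have := ler_normB (p1 + p2 - l q) r1.
move: g1 g2 P1 P2 bl; move: (_^-1 * _) (_^-1 * _) => z1 z2; lra.
Qed.

End weak_solution.

(** * Solvability *)

Section adjoint_linear.
Context {R : realType} {n : nat}.
Local Notation Rn := 'rV[R]_n.
Variables (Om K : set Rn) (oOm : open Om) (cK : compact K) (KOm : K `<=` Om).
Variables (N : nat) (a : nat -> Rn -> Rn) (f : nat -> Rn -> R) (al be : Rn -> R).
Hypothesis sa : forall j, (j <= N.+1)%N -> smooth_vf Om (a j).
Hypothesis sf : forall j, (1 <= j <= N)%N -> smooth Om (f j).
Hypothesis sal : smooth Om al.
Hypothesis sbe : smooth Om be.
Local Notation A := (adjoint_part N a f al be).
Local Notation mu := (lebesgue_rV n).

Lemma eq_ivf b (u v : Rn -> R) x : (forall p, Om p -> u p = v p) -> Om x ->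
  ivf b u x = ivf b v x.
Proof.
move=> uv Omx; apply: eq_bigr => k _.
by rewrite (eq_partial k oOm uv Omx).
Qed.

Lemma ivfDZ b t (u v : Rn -> R) x : smooth Om u -> smooth Om v -> Om x ->
  ivf b (u + t *: v) x = ivf b u x + t * ivf b v x.
Proof.
move=> su sv Omx.
rewrite (_ : u + t *: v = u + cst t * v)//.
by rewrite (ivfD b su (smoothM oOm (smooth_cst t) sv) Omx) (ivfZ b t sv Omx).
Qed.

Lemma ctestDZ t (u v : Rn -> R) : ctest Om K u -> ctest Om K v ->
  ctest Om K (u + t *: v).
Proof.
by move=> su sv; exact: (ctestD oOm su (ctestM oOm (smooth_cst t) sv)).
Qed.

Lemma divvDZ b t (u v : Rn -> R) x : smooth Om u -> smooth Om v -> Om x ->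
  divv b (u + t *: v) x = divv b u x + t * divv b v x.
Proof.
move=> su sv Omx; rewrite /divv (ivfDZ b t su sv Omx).
have -> : (u + t *: v) x = u x + t * v x by [].
ring.
Qed.

Lemma adjoint_partDZ t u v u' v' x :
  smooth Om u -> smooth Om v -> smooth Om u' -> smooth Om v' -> Om x ->
  A (u + t *: u') (v + t *: v') x = A u v x + t * A u' v' x.
Proof.
move=> su sv su' sv' Omx; rewrite /adjoint_part.
rewrite (divvDZ (a 0) t su su' Omx) (divvDZ (a N.+1) t sv sv' Omx).
have -> : (u + t *: u') x = u x + t * u' x by [].
have -> : (v + t *: v') x = v x + t * v' x by [].
have -> : \sum_(1 <= j < N.+1) divv (a j) (f j * ivf (a j) (u + t *: u')) x =
    \sum_(1 <= j < N.+1) divv (a j) (f j * ivf (a j) u) x +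
    t * \sum_(1 <= j < N.+1) divv (a j) (f j * ivf (a j) u') x.
  rewrite mulr_sumr -big_split /=; apply: eq_big_nat => j; rewrite ltnS => jN.
  have sb : smooth_vf Om (a j) by apply: sa; case/andP: jN => _ /leqW.
  have sg w : smooth Om w -> smooth Om (f j * ivf (a j) w).
    by move=> sw; exact: (smoothM oOm (sf jN) (smooth_ivf oOm sb sw)).
  rewrite -(divvDZ (a j) t (sg _ su) (sg _ su') Omx) /divv.
  have E p : Om p -> (f j * ivf (a j) (u + t *: u')) p =
      (f j * ivf (a j) u + t *: (f j * ivf (a j) u')) p.
    move=> Omp; transitivity (f j p * (ivf (a j) u p + t * ivf (a j) u' p)).
      by rewrite -(ivfDZ (a j) t su su' Omp).
    by rewrite mulrDr mulrCA.
  by rewrite (eq_ivf (a j) E Omx) (E x Omx).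
move: (\sum_(1 <= j < N.+1) _) (\sum_(1 <= j < N.+1) _) => s1 s2.
move: (divv _ _ _) (divv _ _ _) (divv _ _ _) (divv _ _ _) (u x) (v x) (u' x) (v' x)
  (al x) (be x) => *.
ring.
Qed.

Let clK : closed K := compact_closed_rV cK.

Let mK : measurable K := compact_measurable_rV cK.

Lemma ctest_L2on h : ctest Om K h -> L2on mu K h.
Proof.
move=> th; split.
  by apply: measurable_funTS; apply: continuous_measurable_rV;
    exact: ctest_continuous th.
have iT : mu.-integrable setT (EFin \o (fun x => h x ^+ 2)).
  exact: (ctest_integrable cK KOm (ctestM oOm th.1 th)).
exact: (integrableS (@measurableT _ _) mK (@subsetT _ _) iT).
Qed.

Lemma integ_pair g h : ctest Om K g -> ctest Om K h -> integ (g * h) = L2_pair mu K g h.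
Proof.
move=> tg th; rewrite /L2_pair [RHS]Rintegral_mkcond; congr integ.
apply/funext => x; rewrite patchE; case: ifPn => // /negP; rewrite inE => nKx.
by rewrite mulrfctE th.2// mulr0.
Qed.

End adjoint_linear.

(** * The distributional equation as a pairing with the adjoint *)

Section distributions.
Context {R : realType} {n : nat}.
Local Notation Rn := 'rV[R]_n.
Variables (Om K : set Rn) (oOm : open Om) (cK : compact K) (KOm : K `<=` Om).
Local Notation mu := (lebesgue_rV n).
Local Notation "<< f , g >>" := (L2_pair mu K f g).
Implicit Types (p q u v : Rn -> R) (phi : Rn -> R[i]).

Let clK : closed K := compact_closed_rV cK.

Let mK : measurable K := compact_measurable_rV cK.

Let mOm : measurable Om := open_measurable_rV oOm.

Let L2 p : ctest Om K p -> L2on mu K p.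
Proof. exact: ctest_L2on. Qed.

Lemma Rintegral_offK (F : Rn -> R) : (forall x, ~ K x -> F x = 0) ->
  Rintegral mu Om F = Rintegral mu K F.
Proof.
move=> F0; rewrite Rintegral_mkcond [RHS]Rintegral_mkcond; congr Rintegral.
apply/funext => x; rewrite !patchE; have [Kx|nKx] := pselect (K x).
  by rewrite !mem_set//; exact: KOm.
by rewrite (memNset nKx) F0//; case: ifP.
Qed.

Section solution.
Variables (w : Rn -> R[i]).
Let w1 x := complex.Re (w x).
Let w2 x := complex.Im (w x).
Hypotheses (Lw1 : L2on mu K w1) (Lw2 : L2on mu K w2).

Definition rpair p q : R := <<w1, p>> + <<w2, q>>.

(* The pairing of w with the test function p + i q, antilinear in the latter. *)
Definition cpair p q : R[i] := (rpair p q +i* rpair (- q) p)%C.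

Lemma pairN_ctest f p : L2on mu K f -> ctest Om K p -> <<f, - p>> = - <<f, p>>.
Proof.
move=> Lf tp.
(* Brings negation into the form [p + t q] for which linearity was proved. *)
have -> : - p = (fun x => p x + (-2) * p x).
  by apply/funext => x; rewrite opprfctE; ring.
by rewrite (pairDZ mK (-2) Lf (L2 tp) (L2 tp)); ring.
Qed.

Lemma pairD_ctest f p q : L2on mu K f -> ctest Om K p -> ctest Om K q ->
  <<f, p + q>> = <<f, p>> + <<f, q>>.
Proof.
move=> Lf tp tq; have -> : p + q = (fun x => p x + 1 * q x).
  by apply/funext => x; rewrite mul1r.
by rewrite (pairDZ mK 1 Lf (L2 tp) (L2 tq)) mul1r.
Qed.

Lemma eq_pairr f p q : (forall x, K x -> p x = q x) -> <<f, p>> = <<f, q>>.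
Proof. by move=> pq; apply: eq_Rintegral => x; rewrite inE => /pq ->. Qed.

Lemma cpair_eq p q p' q' : (forall x, K x -> p x = p' x) ->
  (forall x, K x -> q x = q' x) -> cpair p q = cpair p' q'.
Proof.
move=> pp qq; rewrite /cpair /rpair (eq_pairr w1 pp) (eq_pairr w2 qq) (eq_pairr w2 pp).
by rewrite (@eq_pairr w1 (- q) (- q'))// => x /qq; rewrite !opprfctE => ->.
Qed.

Lemma cpairD p q p' q' : ctest Om K p -> ctest Om K q -> ctest Om K p' ->
  ctest Om K q' -> cpair (p + p') (q + q') = cpair p q + cpair p' q'.
Proof.
move=> tp tq tp' tq'; rewrite /cpair /rpair opprD.
rewrite !pairD_ctest//; try exact: ctestN.
by apply/eqP; rewrite eq_complex /=; apply/andP; split; apply/eqP; ring.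
Qed.

Lemma cpair0 : cpair (cst 0) (cst 0) = 0.
Proof.
have t0 : ctest Om K (cst 0) by exact: ctest0.
have := cpairD t0 t0 t0 t0.
have -> : (cst 0 + cst 0 : Rn -> R) = cst 0 by apply/funext => x; exact: addr0.
by move/eqP; rewrite -subr_eq subrr => /eqP <-.
Qed.

Lemma cpair_sum (I : Type) (r : seq I) (P Q : I -> Rn -> R) :
  (forall i, ctest Om K (P i)) -> (forall i, ctest Om K (Q i)) ->
  \sum_(i <- r) cpair (P i) (Q i) =
  cpair (fun x => \sum_(i <- r) P i x) (fun x => \sum_(i <- r) Q i x).
Proof.
move=> tP tQ; elim: r => [|i r IH].
  rewrite big_nil -cpair0; apply: cpair_eq => x _; by rewrite big_nil.
rewrite big_cons IH -cpairD//; try by apply: (ctest_sum oOm) => j _.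
by apply: cpair_eq => x _; rewrite big_cons.
Qed.

Lemma distr_fun_cpair phi p q : ctest Om K p -> ctest Om K q ->
  (forall x, phi x = (p x +i* q x)%C) -> distr_fun Om w phi = cpair p q.
Proof.
move=> tp tq phiE; rewrite /distr_fun /cintegral /cpair /rpair.
have k0 x : ~ K x -> phi x = 0.
  by move=> nKx; rewrite phiE tp.2// tq.2.
have off (g : R[i] -> R) : g 0 = 0 -> forall x, ~ K x -> g (w x * (phi x)^*%C) = 0.
  by move=> g0 x nKx; rewrite k0// conjc0 mulr0.
rewrite (Rintegral_offK (off (@complex.Re R) erefl)).
rewrite (Rintegral_offK (off (@complex.Im R) erefl)).
have I1 := L2on_mul_integrable mK Lw1 (L2 tp).
have I2 := L2on_mul_integrable mK Lw2 (L2 tq).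
have I3 := L2on_mul_integrable mK Lw2 (L2 tp).
have I4 := L2on_mul_integrable mK Lw1 (L2 (ctestN oOm tq)).
rewrite /L2_pair -(RintegralD mK I1 I2) -(RintegralD mK I4 I3).
apply/eqP; rewrite eq_complex /=; apply/andP; split; apply/eqP; apply: eq_Rintegral => x _;
  rewrite phiE /w1 /w2 ?opprfctE; case: (w x) => c e /=; ring.
Qed.

Lemma ctest_div_term b k p : smooth_vf Om b -> ctest Om K p ->
  ctest Om K (partial k ((fun x => b x ord0 k) * p)).
Proof. by move=> sb tp; apply: (ctest_partial clK); exact: (ctestM oOm (sb k) tp). Qed.

(** The transpose of [X = - i Y] sends [phi = p + i q] to [- i div (phi b)], that is to
    [div (q b) - i div (p b)]. *)
Lemma distr_vf_cpair b phi p q : smooth_vf Om b -> ctest Om K p -> ctest Om K q ->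
  (forall x, phi x = (p x +i* q x)%C) ->
  distr_vf b (distr_fun Om w) phi = cpair (divv b q) (- divv b p).
Proof.
move=> sb tp tq phiE; rewrite /distr_vf.
transitivity (\sum_(k < n) cpair (partial k ((fun x => b x ord0 k) * q))
    (- partial k ((fun x => b x ord0 k) * p))).
  apply: eq_bigr => k _; rewrite /distr_mul /distr_D.
  apply: distr_fun_cpair.
  - exact: ctest_div_term.
  - by apply: (ctestN oOm); exact: ctest_div_term.
  move=> x; rewrite /Dop.
  have -> : (fun y => complex.Re (((b y ord0 k)%:C)^*%C * phi y)) =
      (fun x => b x ord0 k) * p.
    by apply/funext => y; rewrite phiE /= mulrfctE; ring.
  have -> : (fun y => complex.Im (((b y ord0 k)%:C)^*%C * phi y)) =
      (fun x => b x ord0 k) * q.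
    by apply/funext => y; rewrite phiE /= mulrfctE; ring.
  by rewrite opprfctE; simpc.
rewrite cpair_sum; last 2 first.
- by move=> k; exact: ctest_div_term.
- by move=> k; apply: (ctestN oOm); exact: ctest_div_term.
apply: cpair_eq => x Kx; first exact: (div_vf sb tq.1 (KOm Kx)).
transitivity (- \sum_(k < n) partial k ((fun x => b x ord0 k) * p) x).
  by rewrite -sumrN; apply: eq_bigr.
by congr (- _); exact: (div_vf sb tp.1 (KOm Kx)).
Qed.

(** By antilinearity the factor [i] enters the test function as [- i], and
    [- i (p + i q) = q - i p]. *)
Lemma mul_i_cpair p q : ctest Om K p -> ctest Om K q ->
  'i%C * cpair p q = cpair q (- p).
Proof.
move=> tp tq; rewrite /cpair /rpair opprK !pairN_ctest//.
by simpc; apply/eqP; rewrite eq_complex /=; apply/andP; split; apply/eqP; ring.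
Qed.

Lemma Pop_cpair N (a : nat -> Rn -> Rn) (f : nat -> Rn -> R) (a0 : Rn -> R[i]) phi u v :
  (forall j, (j <= N.+1)%N -> smooth_vf Om (a j)) ->
  (forall j, (1 <= j <= N)%N -> smooth Om (f j)) ->
  csmooth Om a0 ->
  ctest Om K u -> ctest Om K v -> (forall x, phi x = (u x +i* v x)%C) ->
  Pop N a f a0 (distr_fun Om w) phi =
  cpair (adjoint_part N a f (fun x => complex.Re (a0 x)) (fun x => complex.Im (a0 x)) u v)
    (adjoint_part N a f (fun x => complex.Re (a0 x)) (fun x => complex.Im (a0 x)) v (- u)).
Proof.
move=> sa sf [sal sbe] tu tv phiE; rewrite /Pop.
set al := fun x => complex.Re (a0 x); set be := fun x => complex.Im (a0 x).
have sy : smooth_vf Om (a 0%N) by exact: sa.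
have sz : smooth_vf Om (a N.+1) by exact: sa.
have ReE : (fun x => complex.Re (phi x)) = u by apply/funext => x; rewrite phiE.
have ImE : (fun x => complex.Im (phi x)) = v by apply/funext => x; rewrite phiE.
have tN p : ctest Om K p -> ctest Om K (- p) := @ctestN _ _ _ _ oOm p.
have tD b p (sb : smooth_vf Om b) (tp : ctest Om K p) : ctest Om K (divv b p).
  exact: (ctest_divv oOm cK sb tp).
(* [cpair_sum] needs test functions at every index, hence the value zero where [a j] and [f j] are
   not known to be smooth. *)
pose F j (p : Rn -> R) : Rn -> R :=
  if (1 <= j <= N)%N then - divv (a j) (f j * ivf (a j) p) else cst 0.
have tF j p : ctest Om K p -> ctest Om K (F j p).
  move=> tp; rewrite /F; case: ifPn => [jN|_]; last exact: ctest0.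
  have sb : smooth_vf Om (a j) by apply: sa; case/andP: jN => _ /leqW.
  exact: (tN _ (tD _ _ sb (ctestM oOm (sf _ jN) (ctest_ivf oOm clK sb tp)))).
have -> : \sum_(1 <= j < N.+1) distr_vf_adj (a j)
      (distr_mul (fun x => (f j x)%:C%C) (distr_vf (a j) (distr_fun Om w))) phi =
    cpair (fun x => \sum_(1 <= j < N.+1) F j u x)
      (fun x => \sum_(1 <= j < N.+1) F j v x).
  rewrite -cpair_sum => [|j|j]; [|exact: tF|exact: tF].
  apply: eq_big_nat => j; rewrite ltnS => jN; rewrite /F jN.
  have sb : smooth_vf Om (a j) by apply: sa; case/andP: jN => _ /leqW.
  have tf p : ctest Om K p -> ctest Om K (f j * ivf (a j) p).
    by move=> tp; exact: (ctestM oOm (sf _ jN) (ctest_ivf oOm clK sb tp)).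
  rewrite /distr_vf_adj /distr_mul.
  rewrite (distr_vf_cpair (p := f j * ivf (a j) v) (q := - (f j * ivf (a j) u)) sb).
  - apply: cpair_eq => // x Kx; have Omx := KOm Kx.
    rewrite /divv (ivfN oOm (a j) (tf _ tu).1 Omx) !opprfctE.
    by rewrite mulrN -opprD.
  - exact: tf.
  - exact/tN/tf.
  move=> x; rewrite vf_opE ReE ImE opprfctE mulrfctE.
  by simpc.
rewrite (distr_vf_cpair (p := u) (q := v) sy tu tv phiE).
rewrite (distr_vf_cpair (p := u) (q := v) sz tu tv phiE).
have -> : distr_mul a0 (distr_fun Om w) phi =
    cpair (al * u + be * v) (al * v - be * u).
  apply: distr_fun_cpair.
  - exact: (ctestD oOm (ctestM oOm sal tu) (ctestM oOm sbe tv)).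
  - exact: (ctestB oOm (ctestM oOm sal tv) (ctestM oOm sbe tu)).
  move=> x; rewrite phiE /al /be !(addrfctE, opprfctE, mulrfctE).
  case: (a0 x) => c e /=; apply/eqP; rewrite eq_complex /=.
  by apply/andP; split; apply/eqP; ring.
rewrite mul_i_cpair; [|exact: tD sy tv|exact/tN/tD].
have tS p : ctest Om K p -> ctest Om K (fun x => \sum_(1 <= j < N.+1) F j p x).
  by move=> tp; apply: (ctest_sum oOm) => j _; exact: tF.
have t1 := tS _ tu; have t2 := tS _ tv.
have t3 := tN _ (tD _ _ sy tu); have t4 := tN _ (tD _ _ sy tv).
have t5 := tD _ _ sz tv; have t6 := tN _ (tD _ _ sz tu).
have t7 : ctest Om K (al * u + be * v).
  exact: (ctestD oOm (ctestM oOm sal tu) (ctestM oOm sbe tv)).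
have t8 : ctest Om K (al * v - be * u).
  exact: (ctestB oOm (ctestM oOm sal tv) (ctestM oOm sbe tu)).
have t13 := ctestD oOm t1 t3; have t24 := ctestD oOm t2 t4.
rewrite -(cpairD t1 t2 t3 t4) -(cpairD t13 t24 t5 t6).
rewrite -(cpairD (ctestD oOm t13 t5) (ctestD oOm t24 t6) t7 t8).
have SE p x : \sum_(1 <= j < N.+1) F j p x =
    - \sum_(1 <= j < N.+1) divv (a j) (f j * ivf (a j) p) x.
  by rewrite -sumrN; apply: eq_big_nat => j; rewrite ltnS => jN; rewrite /F jN.
have addE p q x : (p + q) x = p x + q x by [].
have mulE p q x : (p * q) x = p x * q x by [].
have oppE p x : (- p) x = - p x by [].
apply: cpair_eq => x Kx; rewrite !(addE, oppE, mulE) SE /adjoint_part.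
  by rewrite !addrA.
have -> : divv (a N.+1) (- u) x = - divv (a N.+1) u x.
  by rewrite /divv (ivfN oOm (a N.+1) tu.1 (KOm Kx)) oppE mulrN -opprD.
by rewrite oppE mulrN !addrA.
Qed.

End solution.

End distributions.

Section solvability.
Context {R : realType} {n : nat}.
Local Notation Rn := 'rV[R]_n.
Variables (Om K : set Rn) (oOm : open Om) (cK : compact K) (KOm : K `<=` Om).
Variables (N : nat) (a : nat -> Rn -> Rn) (f : nat -> Rn -> R) (al be : Rn -> R).
Hypothesis sa : forall j, (j <= N.+1)%N -> smooth_vf Om (a j).
Hypothesis sf : forall j, (1 <= j <= N)%N -> smooth Om (f j).
Hypothesis sal : smooth Om al.
Hypothesis sbe : smooth Om be.
Local Notation A := (adjoint_part N a f al be).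
Local Notation mu := (lebesgue_rV n).
Local Notation "<< f , g >>" := (L2_pair mu K f g).
Variable c : R.
Hypothesis c_ge0 : 0 <= c.
Hypothesis estimate : forall u v, ctest Om K u -> ctest Om K v ->
  integ (u * u + v * v) <= c * integ (A u v * A u v + A v (- u) * A v (- u)).

Let clK : closed K := compact_closed_rV cK.

Let mK : measurable K := compact_measurable_rV cK.

Let L2 p : ctest Om K p -> L2on mu K p.
Proof. exact: ctest_L2on. Qed.

Lemma compact_measure_finite : (mu K < +oo)%E.
Proof.
have [M [_ MK]] := compact_bounded cK.
apply: (@lebesgue_rV_bounded _ _ _ (M + 1)) => // x Kx.
have MM : M < M + 1 by rewrite ltrDl.
exact: MK (M + 1) MM x Kx.
Qed.

(** The minimization runs on the real vector space of pairs [(u, v)], so only the real part of the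
    weak equation comes out, for every pair. *)
Lemma adjoint_solution g1 g2 : L2on mu K g1 -> L2on mu K g2 ->
  exists w1 w2, [/\ L2on mu K w1, L2on mu K w2 &
    forall u v, ctest Om K u -> ctest Om K v ->
      <<w1, A u v>> + <<w2, A v (- u)>> = <<g1, u>> + <<g2, v>>].
Proof.
move=> Lg1 Lg2.
pose V : lmodType R := ((Rn -> R) * (Rn -> R))%type.
pose S : set V := [set p | ctest Om K p.1 /\ ctest Om K p.2].
have tA u v : ctest Om K u -> ctest Om K v -> ctest Om K (A u v).
  exact: (ctest_adjoint_part oOm cK sa sf sal sbe).
have tN p : ctest Om K p -> ctest Om K (- p) := @ctestN _ _ _ _ oOm p.
pose c1 := c + 1; have c10 : 0 < c1 by rewrite ltr_wpDl.
have ii u v : ctest Om K u -> ctest Om K v -> integ (u * u + v * v) = <<u, u>> + <<v, v>>.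
  move=> tu tv; rewrite (integD cK KOm (ctestM oOm tu.1 tu) (ctestM oOm tv.1 tv)).
  by rewrite (integ_pair tu tu) (integ_pair tv tv).
have [||||||||w1 [w2 [Lw1 Lw2 H]]] := @weak_solution_exists R _ Rn mu K mK
  compact_measure_finite V S (fun p => A p.1 p.2) (fun p => A p.2 (- p.1))
  (fun p => <<g1, p.1>> + <<g2, p.2>>) (4 * c1 * (<<g1, g1>> + <<g2, g2>>)).
- by split; exact: ctest0.
- by move=> t x w [x1 x2] [y1 y2]; split; exact: ctestDZ.
- by move=> x [x1 x2]; exact: (L2 (tA _ _ x1 x2)).
- by move=> x [x1 x2]; exact: (L2 (tA _ _ x2 (tN _ x1))).
- move=> t x w p [x1 x2] [y1 y2] Kp.
  exact: (adjoint_partDZ oOm al be sa sf t x1.1 x2.1 y1.1 y2.1 (KOm Kp)).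
- move=> t x w p [x1 x2] [y1 y2] Kp.
  have -> : - (x + t *: w).1 = - x.1 + t *: (- w.1) by rewrite opprD scalerN.
  exact: (adjoint_partDZ oOm al be sa sf t x2.1 (tN _ x1).1 y2.1 (tN _ y1).1 (KOm Kp)).
- move=> t x w [x1 x2] [y1 y2] /=.
  have E g p q : L2on mu K g -> ctest Om K p -> ctest Om K q ->
      <<g, p + t *: q>> = <<g, p>> + t * <<g, q>>.
    by move=> Lg tp tq; rewrite -(pairDZ mK t Lg (L2 tp) (L2 tq)).
  by rewrite (E _ _ _ Lg1 x1 y1) (E _ _ _ Lg2 x2 y2); ring.
- move=> x [x1 x2].
  have t1 := tA _ _ x1 x2; have t2 := tA _ _ x2 (tN _ x1).
  have est := estimate x1 x2; rewrite (ii _ _ x1 x2) (ii _ _ t1 t2) in est.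
  (* With this weight, twice the functional is at most [4 c1 |g|^2 + |phi|^2 / c1], and the estimate
     bounds the last term by [|P^* phi|^2]. Taking [c1 = c + 1] avoids dividing by a possibly zero
     [c]. *)
  have e0 : 0 < (2 * c1)^-1 by rewrite invr_gt0 mulr_gt0.
  have P1 := pair_bound mK e0 Lg1 (L2 x1); have P2 := pair_bound mK e0 Lg2 (L2 x2).
  have b0 : 0 <= <<A x.1 x.2, A x.1 x.2>> + <<A x.2 (- x.1), A x.2 (- x.1)>>.
    by rewrite addr_ge0// pair_ge0.
  rewrite !invrK in P1 P2.
  have h1 := le_trans (ler_norm _) P1; have h2 := le_trans (ler_norm _) P2.
  move: est h1 h2 b0; rewrite -/A.
  move: (L2_pair _ _ (A _ _) _) (L2_pair _ _ (A _ _) _) (L2_pair _ _ x.1 x.1) (L2_pair _ _ x.2 x.2).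
  move: (L2_pair _ _ g1 g1) (L2_pair _ _ g2 g2) (L2_pair _ _ g1 _) (L2_pair _ _ g2 _).
  move=> G1 G2 l1 l2 B2 B1 u2 v2 est h1 h2 b0.
  have : (2 * c1)^-1 * (u2 + v2) <= 2^-1 * (B1 + B2).
    have -> : 2^-1 * (B1 + B2) = (2 * c1)^-1 * (c1 * (B1 + B2)).
      by field; rewrite gt_eqF.
    rewrite (ler_pM2l e0); apply: (le_trans est); apply: ler_wpM2r => //.
    by rewrite /c1 lerDl.
  lra.
exists w1, w2; split => // u v tu tv.
exact: (H (u, v) (conj tu tv)).
Qed.

End solvability.

Lemma L2loc_L2on (R : realType) (n : nat) (Om K : set 'rV[R]_n) (g : 'rV[R]_n -> R[i]) :
  open Om -> compact K -> K `<=` Om -> L2loc Om g ->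
  L2on (lebesgue_rV n) K (fun x => complex.Re (g x)) /\
  L2on (lebesgue_rV n) K (fun x => complex.Im (g x)).
Proof.
move=> oOm cK KOm [m1 m2 fin].
have mOm : measurable Om by exact: open_measurable_rV.
have mK := compact_measurable_rV cK.
have {}m1 := measurable_funS mOm KOm m1; have {}m2 := measurable_funS mOm KOm m2.
have {}fin := fin K cK KOm.
have ms : measurable_fun K (fun x => (complex.Re (g x) ^+ 2 + complex.Im (g x) ^+ 2)%:E).
  by apply/measurable_EFinP; apply: measurable_funD; exact: measurable_funX.
split; apply: L2onP => //; apply: le_lt_trans fin; apply: ge0_le_integral => //.
- by move=> x _; rewrite lee_fin sqr_ge0.
- by apply/measurable_EFinP; exact: measurable_funX.
- by move=> x _; rewrite lee_fin lerDl sqr_ge0.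
- by move=> x _; rewrite lee_fin sqr_ge0.
- by apply/measurable_EFinP; exact: measurable_funX.
- by move=> x _; rewrite lee_fin lerDr sqr_ge0.
Qed.

(** Extension by zero makes the solution found on [K] square integrable over the whole space, hence
    over every compact subset of [Om]. *)
Lemma L2on_patch_L2loc (R : realType) (n : nat) (Om K : set 'rV[R]_n)
  (h1 h2 : 'rV[R]_n -> R) : open Om -> compact K ->
  L2on (lebesgue_rV n) K h1 -> L2on (lebesgue_rV n) K h2 ->
  L2loc Om (fun x => ((h1 \_ K) x +i* (h2 \_ K) x)%C).
Proof.
move=> oOm cK [m1 i1] [m2 i2].
have mK := compact_measurable_rV cK.
have {}m1 := (measurable_restrictT h1 mK).1 m1.
have {}m2 := (measurable_restrictT h2 mK).1 m2.
split=> /=; [exact: measurable_funTS|exact: measurable_funTS|move=> K' cK' _].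
have mK' := compact_measurable_rV cK'.
have ms : measurable_fun setT (fun x => ((h1 \_ K) x ^+ 2 + (h2 \_ K) x ^+ 2)%:E).
  by apply/measurable_EFinP; apply: measurable_funD; exact: measurable_funX.
apply: (@le_lt_trans _ _
  (\int[lebesgue_rV n]_x ((h1 \_ K) x ^+ 2 + (h2 \_ K) x ^+ 2)%:E)%E).
  by apply: ge0_subset_integral => // x _; rewrite lee_fin addr_ge0 ?sqr_ge0.
rewrite (_ : (fun x => _) =
    (((EFin \o (fun x => (h1 x ^+ 2)%R)) \+ (EFin \o (fun x => (h2 x ^+ 2)%R))) \_ K)%E).
  rewrite -integral_mkcond.
  have := integrable_fin_num mK (integrableD mK i1 i2).
  by rewrite fin_numE => /andP[_]; rewrite -ltey.
apply/funext => x; rewrite !patchE; case: ifP => // _.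
by rewrite expr0n addr0.
Qed.

Lemma test_fun_ctest (R : realType) (n : nat) (Om K : set 'rV[R]_n)
  (phi : 'rV[R]_n -> R[i]) : test_fun (interior K) phi ->
  ctest Om K (fun x => complex.Re (phi x)) /\ ctest Om K (fun x => complex.Im (phi x)).
Proof.
move=> [[s1 s2] _ supp].
have k0 x : ~ K x -> phi x = 0.
  move=> nKx; apply/eqP/negPn/negP => px; apply: nKx; apply: interior_subset.
  by apply: supp; exact: subset_closure.
by split; split; [exact: smoothW s1| |exact: smoothW s2|] => // x /k0 ->.
Qed.

Theorem theorem1 (R : realType) (n N : nat) (Om : set 'rV[R]_n)
  (a : nat -> 'rV[R]_n -> 'rV[R]_n) (f : nat -> 'rV[R]_n -> R)
  (a0 : 'rV[R]_n -> R[i])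
  (N_ge1 : (1 <= N)%N)
  (Om_open : open Om)
  (a_smooth : forall j, (j <= N.+1)%N ->
     forall k : 'I_n, smooth Om (fun x => a j x ord0 k))
  (f_smooth : forall j, (1 <= j <= N)%N -> smooth Om (f j))
  (a0_smooth : csmooth Om a0)
  (X0_neq0 : forall x, Om x -> a 0%N x != 0)
  (iX0f_ge0 : forall j, (1 <= j <= N)%N ->
     forall x, Om x -> 0 <= ivf (a 0%N) (f j) x)
  (X0_comm : forall j, (1 <= j <= N)%N ->
     forall phi, csmooth Om phi -> forall x, Om x ->
       commutator (vf_op (a 0%N)) (vf_op (a j)) phi x = 0)
  (poisson_bound : forall x0, Om x0 ->
     exists (U : set 'rV[R]_n) (C : R),
       [/\ open U, bounded_set U, U `<=` Om, U x0 & 0 < C /\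
         forall x xi, U x ->
           `|poisson (vf_symbol (a 0%N)) (vf_symbol (a N.+1)) x xi| ^+ 2 <=
           C * (\sum_(1 <= j < N.+1)
                  ivf (a 0%N) (f j) x * vf_symbol (a j) x xi ^+ 2
                + vf_symbol (a 0%N) x xi ^+ 2)]) :
  forall x0, Om x0 -> L2_locally_solvable Om (Pop N a f a0) x0.
Proof.
move=> x0 Omx0.
have [K [c [cK KOm Kx0 c0 est]]] := local_estimate Om_open a_smooth f_smooth a0_smooth
  X0_neq0 iX0f_ge0 X0_comm poisson_bound Omx0.
have [sal sbe] := a0_smooth.
exists K; split=> // g Lg.
have [Lg1 Lg2] := L2loc_L2on Om_open cK KOm Lg.
have [h1 [h2 [Lh1 Lh2 hE]]] := adjoint_solution Om_open cK KOm a_smooth f_smooth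
  sal sbe c0 est Lg1 Lg2.
exists (fun x => ((h1 \_ K) x +i* (h2 \_ K) x)%C).
  exact: L2on_patch_L2loc.
move=> phi /(test_fun_ctest Om)[tu tv].
have phiE x : phi x = (complex.Re (phi x) +i* complex.Im (phi x))%C by case: (phi x).
have mK := compact_measurable_rV cK.
have patch h p : L2_pair (lebesgue_rV n) K (h \_ K) p = L2_pair (lebesgue_rV n) K h p.
  by apply: eq_Rintegral => x Kx; rewrite patchE Kx.
have Lpatch h : L2on (lebesgue_rV n) K h -> L2on (lebesgue_rV n) K (h \_ K).
  move=> [mh ih]; split.
    by apply: measurable_funTS; exact/(measurable_restrictT h mK).
  by apply: eq_integrable ih => // x Kx /=; rewrite patchE Kx.
rewrite (Pop_cpair Om_open cK KOm (w := fun x => ((h1 \_ K) x +i* (h2 \_ K) x)%C)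
  (Lpatch _ Lh1) (Lpatch _ Lh2) a_smooth f_smooth a0_smooth tu tv phiE).
rewrite (distr_fun_cpair Om_open cK KOm Lg1 Lg2 tu tv phiE).
set u := fun x => complex.Re (phi x); set v := fun x => complex.Im (phi x).
set al := fun x => complex.Re (a0 x); set be := fun x => complex.Im (a0 x).
have E1 := hE u v tu tv.
(* Multiplying phi by i replaces (u, v) by (- v, u). *)
have E2 := hE (- v) u (ctestN Om_open tv) tu.
(* Oddness, read off from linearity with [t = -2], since [w + (-2) w = - w]. *)
have NA x : K x -> adjoint_part N a f al be (- v) u x =
    (- adjoint_part N a f al be v (- u)) x.
  move=> Kx; have su' := (ctestN Om_open tu).1.
  have := adjoint_partDZ Om_open al be a_smooth f_smooth (-2) tv.1 su' tv.1 su' (KOm _ Kx).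
  have D2 (w : 'rV[R]_n -> R) : w + (-2) *: w = - w.
    apply/funext => p; have -> : (w + (-2) *: w) p = w p + (-2) * w p by [].
    by rewrite opprfctE; ring.
  rewrite !D2 opprK => ->; rewrite -[RHS]/(- adjoint_part N a f al be v (- u) x); ring.
rewrite opprK (eq_pairr h1 NA) in E2.
rewrite /cpair /rpair /= !patch.
by congr (_ +i* _)%C; [exact: E1|exact: E2].
Qed.
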